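(* Let $(M,\omega)$ be an $n$-plectic manifold with associated symmetric Lie $n$-algebra structure $\mu=l_1+\cdots+l_{n+1}$ on $E=E_{-n}\oplus\cdots\oplus E_{-1}$. For any $n$-form $\eta$ on $M$ and any $i=2,\dots,n$, let $\widetilde{\eta}_i$ be the symmetric vector valued $i$-form of degree zero on $E$ given by $$\widetilde{\eta}_i(\beta_1,\dots,\beta_i)=\begin{cases}\iota_{\chi_{\beta_1}}\cdots\iota_{\chi_{\beta_i}}\eta,&\text{if }\beta_1,\dots,\beta_i\in E_{-1},\\0,&\text{if some homogeneous }\beta_j\notin E_{-1},\end{cases}$$ where $\chi_{\beta_j}$ is the Hamiltonian vector field of $\beta_j$. Let $S:E\to E$ be the Euler map $S(X)=-|X|X$. Then $S+\widetilde{\eta}_i$ is a Nijenhuis vector valued form with respect to $\mu$, with square $S+2\widetilde{\eta}_i$. The deformed structure is $$[S+\widetilde{\eta}_i,\mu]_{_{RN}}=\mu+[\widetilde{\eta}_i,l_1]_{_{RN}}+[\widetilde{\eta}_i,l_2]_{_{RN}}.$$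
   Context: An $n$-plectic manifold is a manifold $M$ with a closed non-degenerate $(n+1)$-form $\omega$ (non-degenerate: $\iota_v\omega=0$ implies $v=0$). An $(n-1)$-form $\alpha$ is Hamiltonian if there is a vector field $\chi_\alpha$ (its Hamiltonian vector field, unique by non-degeneracy) with $d\alpha=-\iota_{\chi_\alpha}\omega$; $\Omega^{n-1}_{Ham}(M)$ is the space of Hamiltonian forms. The associated symmetric Lie $n$-algebra: $E_{-1}=\Omega^{n-1}_{Ham}(M)$, $E_i=\Omega^{n+i}(M)$ for $-n\le i\le-2$, $E=\oplus_{i=-n}^{-1}E_i$, $|\alpha|$ the degree in $E$; $\mu=\sum_k l_k$ where $l_1(\alpha)=(-1)^{|\alpha|}d\alpha$ for homogeneous $\alpha\notin E_{-1}$, $l_1(\alpha)=0$ for $\alpha\in E_{-1}$; and for $k\ge2$, $l_k(\alpha_1,\dots,\alpha_k)=0$ if some homogeneous $\alpha_i\notin E_{-1}$, while for all $\alpha_i\in E_{-1}$, $l_k(\alpha_1,\dots,\alpha_k)=(-1)^{\frac k2+1}\iota_{\chi_{\alpha_1}}\cdots\iota_{\chi_{\alpha_k}}\omega$ if $k$ is even, and $(-1)^{\frac{k-1}2}\iota_{\chi_{\alpha_1}}\cdots\iota_{\chi_{\alpha_k}}\omega$ if $k$ is odd. For a graded vector space $E$: a symmetric vector valued $k$-form is a graded symmetric $k$-linear map $K:E^k\to E$ (for $k=0$ an element of $E$), of degree $\bar K$ if $|K(X_1,\dots,X_k)|=\sum|X_i|+\bar K$; vector valued forms are formal sums of these. For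 a $k$-form $K$ and an $l$-form $L$ ($l\ge1$), $$\iota_KL(X_1,\dots,X_{k+l-1})=\sum_{\sigma\in Sh(k,l-1)}\epsilon(\sigma)L(K(X_{\sigma(1)},\dots,X_{\sigma(k)}),X_{\sigma(k+1)},\dots,X_{\sigma(k+l-1)}),$$ with $Sh$ the unshuffles and $\epsilon(\sigma)$ the Koszul sign; $\iota_KL=0$ if $L\in E$; $\iota_XK=K(X,\cdot,\dots)$ for $X\in E$. Richardson-Nijenhuis bracket: $[K,L]_{_{RN}}=\iota_KL-(-1)^{\bar K\bar L}\iota_LK$, extended to formal sums. For $\mu$ of degree $1$, a form $\mathcal N$ of degree zero is Nijenhuis with respect to $\mu$ with square $\mathcal K$ if $\mathcal K$ has degree zero, $[\mathcal N,[\mathcal N,\mu]_{_{RN}}]_{_{RN}}=[\mathcal K,\mu]_{_{RN}}$ and $[\mathcal N,\mathcal K]_{_{RN}}=0$. The deformed structure is $[\mathcal N,\mu]_{_{RN}}$. *)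

(* Defs.v *)
From HB Require Import structures.
From mathcomp Require Import all_boot all_order perm all_algebra.
From mathcomp Require Import boolp classical_sets functions reals topology.
From mathcomp Require Import normedtype derive.
From mathcomp Require Import ring.

Set Implicit Arguments.
Unset Strict Implicit.
Unset Printing Implicit Defensive.
Import Order.TTheory GRing.Theory Num.Theory numFieldNormedType.Exports.
Local Open Scope classical_set_scope.
Local Open Scope ring_scope.

Lemma near_eq_continuous (T V : topologicalType) (f g : T -> V) (x : T) :
  (\forall y \near x, f y = g y) ->
  {for x, continuous f} -> {for x, continuous g}.
Proof.
move=> e cf; rewrite /prop_for /continuous_at -(nbhs_singleton e).
exact: cvg_trans (near_eq_cvg e) cf.
Qed.

Section EuclideanSmooth.
Variables (R : realType) (m : nat).
Implicit Types (U : set 'rV[R]_m) (f g : 'rV[R]_m -> R) (k : nat).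

(* All partial derivatives of order at most k exist and are continuous at the
   points of U. The functions are total, but as U is meant to be open only their
   restrictions to U matter. *)
Fixpoint Ck k U f : Prop :=
  (forall x, U x -> {for x, continuous f}) /\
  (if k is k'.+1 then
     forall j : 'I_m, (forall x, U x -> derivable f x (delta_mx 0 j)) /\
                      Ck k' U ('D_(delta_mx 0 j) f)
   else True).

Definition smooth_on U f := forall k, Ck k U f.

Lemma Ck_eq k U f g : open U -> (forall x, U x -> f x = g x) ->
  Ck k U f -> Ck k U g.
Proof.
move=> oU; have near_eq (h1 h2 : 'rV[R]_m -> R) x : U x ->
    (forall x, U x -> h1 x = h2 x) -> \forall y \near x, h1 y = h2 y.
  move=> Ux e; near=> y; apply: e; near: y.
  exact: open_nbhs_nbhs.
elim: k f g => [|k IH] f g e /=.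
  move=> [cf _]; split=> // x Ux.
  by apply: near_eq_continuous (near_eq f g x Ux e) (cf x Ux).
move=> [cf df]; split.
  move=> x Ux.
  by apply: near_eq_continuous (near_eq f g x Ux e) (cf x Ux).
move=> j; have [d1 d2] := df j; split.
  move=> x Ux; have := d1 x Ux.
  by apply: near_eq_derivable; exact: (near_eq f g x Ux e).
apply: IH d2 => x Ux.
by apply: near_eq_derive; exact: (near_eq f g x Ux e).
Unshelve. all: by end_near. Qed.

Lemma CkS k U f : Ck k.+1 U f -> Ck k U f.
Proof.
elim: k f => [|k IH] f; first by move=> [].
by move=> [cf df]; split=> // j; have [d1 d2] := df j; split=> //; apply: IH.
Qed.

Lemma Ck_cst k U (c : R) : open U -> Ck k U (fun=> c).
Proof.
move=> oU; elim: k c => [|k IH] c.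
  by split=> // x _; exact: cst_continuous.
split=> [x _|j]; first exact: cst_continuous.
split=> [x _|]; first exact: derivable_cst.
apply: Ck_eq (IH 0) => // x _.
by rewrite derive_cst.
Qed.

Lemma CkD k U f g : open U -> Ck k U f -> Ck k U g -> Ck k U (fun x => f x + g x).
Proof.
move=> oU; elim: k f g => [|k IH] f g.
  by move=> [cf _] [cg _]; split=> // x Ux; apply: continuousD; [exact: cf|exact: cg].
move=> [cf df] [cg dg]; split=> [x Ux|j].
  by apply: continuousD; [exact: cf|exact: cg].
have [d1 d2] := df j; have [e1 e2] := dg j; split=> [x Ux|].
  by apply: derivableD; [exact: d1|exact: e1].
apply: Ck_eq (IH _ _ d2 e2) => // x Ux.
by rewrite [RHS]deriveD//; [exact: d1|exact: e1].
Qed.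

Lemma CkM k U f g : open U -> Ck k U f -> Ck k U g -> Ck k U (fun x => f x * g x).
Proof.
move=> oU; elim: k f g => [|k IH] f g.
  by move=> [cf _] [cg _]; split=> // x Ux; apply: continuousM; [exact: cf|exact: cg].
move=> Hf Hg; have [cf df] := Hf; have [cg dg] := Hg; split=> [x Ux|j].
  by apply: continuousM; [exact: cf|exact: cg].
have [d1 d2] := df j; have [e1 e2] := dg j; split=> [x Ux|].
  by apply: derivableM; [exact: d1|exact: e1].
have H := CkD oU (IH _ _ (CkS Hf) e2) (IH _ _ (CkS Hg) d2).
apply: Ck_eq H => // x Ux.
by rewrite [RHS]deriveM//; [exact: d1|exact: e1].
Qed.

End EuclideanSmooth.
Record manifold (R : realType) (m : nat) := Manifold {
  manifold_point :> topologicalType;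
  manifold_hausdorff : hausdorff_space manifold_point;
  manifold_second_countable : @second_countable manifold_point;
  chart_index : Type;
  chart_dom : chart_index -> set manifold_point;
  chart : chart_index -> manifold_point -> 'rV[R]_m;
  chart_inv : chart_index -> 'rV[R]_m -> manifold_point;
  chart_cover : forall p, exists i, chart_dom i p;
  chart_dom_open : forall i, open (chart_dom i);
  chart_img_open : forall i, open (chart i @` chart_dom i);
  chartK : forall i p, chart_dom i p -> chart_inv i (chart i p) = p;
  chart_continuous : forall i p, chart_dom i p ->
    {for p, continuous (chart i)};
  chart_inv_continuous : forall i x, (chart i @` chart_dom i) x ->
    {for x, continuous (chart_inv i)};
  chart_transition : forall i j c,
    smooth_on (chart i @` (chart_dom i `&` chart_dom j))
              (fun x => chart j (chart_inv i x) 0 c)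
}.

Section SmoothFunctions.
Variables (R : realType) (m : nat) (M : manifold R m).

Definition smooth : {pred M -> R^o} := [pred f : M -> R^o |
  `[< forall i, smooth_on (chart i @` chart_dom i) (f \o chart_inv i) >]].

Fact smooth_subring : subring_closed smooth.
Proof.
split.
- apply/asboolP => i k; apply: Ck_cst; exact: chart_img_open.
- move=> f g /asboolP Hf /asboolP Hg; apply/asboolP => i k.
  have o := @chart_img_open _ _ M i.
  have HN : Ck k (chart i @` chart_dom i) (fun x => -1 * (g \o chart_inv i) x).
    by apply: CkM (Hg i k) => //; exact: Ck_cst.
  by apply: Ck_eq (CkD o (Hf i k) HN) => // x _; rewrite mulN1r.
- move=> f g /asboolP Hf /asboolP Hg; apply/asboolP => i k.
  by apply: CkM; [exact: chart_img_open|exact: Hf|exact: Hg].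
Qed.

Fact smooth_submod : submod_closed smooth.
Proof.
split; first by apply/asboolP => i k; apply: Ck_cst; exact: chart_img_open.
move=> c f g /asboolP Hf /asboolP Hg; apply/asboolP => i k.
have o := @chart_img_open _ _ M i.
by apply: CkD (Hg i k) => //; apply: CkM (Hf i k) => //; exact: Ck_cst.
Qed.

Record smooth_fun := SmoothFun {
  smooth_val :> M -> R^o; _ : smooth_val \in smooth }.

HB.instance Definition _ := [isSub for smooth_val].
HB.instance Definition _ := [Choice of smooth_fun by <:].
HB.instance Definition _ :=
  GRing.SubChoice_isSubComPzRing.Build _ _ smooth_fun smooth_subring.
HB.instance Definition _ := GRing.SubZmodule_isSubLmodule.Build R (M -> R^o)
  _ smooth_fun (GRing.submod_closed_semi smooth_submod).

Fact smooth_scaler_mul (c : R) (f g : smooth_fun) : c *: (f * g) = (c *: f) * g.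
Proof. by apply: val_inj; apply: funext => p; exact: mulrA. Qed.


End SmoothFunctions.

Section VectorFields.
Variables (R : realType) (m : nat) (M : manifold R m).
Local Notation A := (smooth_fun M).

Lemma scaler_mulr (c : R) (f g : A) : c *: (f * g) = f * (c *: g).
Proof. by rewrite mulrC smooth_scaler_mul mulrC. Qed.

(* The C^oo(M)-module of smooth vector fields is the module of the R-linear
   derivations of C^oo(M). *)
Definition is_derivation (X : A -> A) :=
  [/\ forall f g, X (f + g) = X f + X g,
      forall (c : R) f, X (c *: f) = c *: X f
    & forall f g, X (f * g) = f * X g + g * X f].

Definition derivation : {pred A -> A^o} :=
  [pred X : A -> A^o | `[< is_derivation X >]].

Fact derivation_submod : submod_closed derivation.
Proof.
split.
  apply/asboolP; split=> [f g|c f|f g].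
  - exact: (esym (addr0 (0 : A))).
  - exact: (esym (scaler0 A c)).
  - by rewrite [RHS](_ : _ = (f * 0 + g * 0 : A))// !mulr0 addr0.
move=> a X Y /asboolP[XD XZ XM] /asboolP[YD YZ YM].
have E h : (a *: X + Y) h = a * (X h : A) + Y h :> A by [].
apply/asboolP; split=> [f g|c f|f g]; rewrite !E.
- by rewrite XD YD mulrDr addrACA.
- by rewrite XZ YZ scalerDr scaler_mulr.
- rewrite XM YM !mulrDr [a * (f * _)]mulrCA [a * (g * _)]mulrCA.
  by rewrite addrACA.
Qed.

Record vector_field := VectorField {
  vf_val : A -> A^o; _ : vf_val \in derivation }.

HB.instance Definition _ := [isSub for vf_val].
HB.instance Definition _ := [Choice of vector_field by <:].
HB.instance Definition _ := GRing.SubChoice_isSubLmodule.Build A (A -> A^o)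
  _ vector_field (GRing.submod_closed_semi derivation_submod).

Definition vf_app (X : vector_field) : A -> A := vf_val X.
Coercion vf_app : vector_field >-> Funclass.
Arguments vf_app : simpl never.

Implicit Types (X Y Z : vector_field) (f g : A).

Lemma vfP X : is_derivation X.
Proof. by apply/asboolP; case: X. Qed.

Lemma vf_eqP X Y : (forall f, X f = Y f) -> X = Y.
Proof. by move=> e; apply: val_inj; apply: funext. Qed.

Lemma vfD X f g : X (f + g) = X f + X g.
Proof. by have [] := vfP X. Qed.
Lemma vfZ X (c : R) f : X (c *: f) = c *: X f.
Proof. by have [] := vfP X. Qed.
Lemma vfM X f g : X (f * g) = f * X g + g * X f.
Proof. by have [] := vfP X. Qed.
Lemma vf0 X : X 0 = 0.
Proof. by apply: (addrI (X 0)); rewrite -vfD !addr0. Qed.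
Lemma vfN X f : X (- f) = - X f.
Proof. by apply: (addrI (X f)); rewrite -vfD !subrr vf0. Qed.
Lemma add_vfE X Y f : (X + Y) f = X f + Y f. Proof. by []. Qed.
Lemma scale_vfE (a : A) X f : (a *: X) f = a * X f. Proof. by []. Qed.
Lemma opp_vfE X f : (- X) f = - X f. Proof. by []. Qed.
Lemma zero_vfE f : (0 : vector_field) f = 0. Proof. by []. Qed.

Fact lie_bracket_subproof X Y : (fun f => X (Y f) - Y (X f)) \in derivation.
Proof.
apply/asboolP; split=> [f g|c f|f g].
- by rewrite !vfD opprD addrACA.
- by rewrite !vfZ scalerBr.
- rewrite !(vfM, vfD); ring.
Qed.

Definition lie_bracket X Y : vector_field := VectorField (lie_bracket_subproof X Y).

Lemma lie_bracketE X Y f : lie_bracket X Y f = X (Y f) - Y (X f).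
Proof. by []. Qed.

Lemma lie_bracketxx X : lie_bracket X X = 0.
Proof. by apply: vf_eqP => f; rewrite lie_bracketE subrr. Qed.

Lemma lie_bracket_linr X (a : A) Y Z :
  lie_bracket X (a *: Y + Z) = a *: lie_bracket X Y + (X a *: Y + lie_bracket X Z).
Proof.
apply: vf_eqP => f.
rewrite !(add_vfE, scale_vfE, lie_bracketE) !(vfD, vfM); ring.
Qed.

Lemma lie_bracket_linl X (a : A) Y Z :
  lie_bracket (a *: Y + Z) X = a *: lie_bracket Y X + (- (X a) *: Y + lie_bracket Z X).
Proof.
apply: vf_eqP => f.
rewrite !(add_vfE, scale_vfE, lie_bracketE) !(vfD, vfM); ring.
Qed.

Lemma lie_jacobi X Y Z :
  lie_bracket X (lie_bracket Y Z) =
  lie_bracket (lie_bracket X Y) Z + lie_bracket Y (lie_bracket X Z).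
Proof.
apply: vf_eqP => f.
rewrite !(add_vfE, lie_bracketE) !(vfD, vfN); ring.
Qed.

End VectorFields.

Section Forms.
Variables (R : realType) (m : nat) (M : manifold R m).
Local Notation A := (smooth_fun M).
Local Notation V := (vector_field M).
Local Notation cochain := (seq V -> A).
Implicit Types (w : cochain) (s : seq V) (X Y Z : V) (a : A) (k : nat).

(* A smooth k-form is an alternating C^oo(M)-multilinear map taking k vector
   fields to a smooth function. To avoid casts between degrees, it is encoded as
   a map on the sequences of vector fields of any size which vanishes on those of
   size other than k; a multilinear alternating map on sequences is thus an
   inhomogeneous form. *)
Definition multilinear w := forall s1 s2 a X Y,
  w (s1 ++ (a *: X + Y) :: s2) = a * w (s1 ++ X :: s2) + w (s1 ++ Y :: s2).

Definition alternating w := forall s, ~~ uniq s -> w s = 0.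

Definition is_form k w :=
  [/\ multilinear w, alternating w & forall s, size s != k -> w s = 0].

(* [contracts [:: X1; ...; Xk] w] is iota_X1 (... (iota_Xk w)). *)
Definition contract X w : cochain := fun s => w (X :: s).

Definition contracts s w : cochain := foldr contract w s.

Definition drop_nth (i : nat) s := take i s ++ drop i.+1 s.

Lemma drop_nth0 X s : drop_nth 0 (X :: s) = s.
Proof. by rewrite /drop_nth /= drop0. Qed.

(* Koszul's formula, normalised so that df(X) = X f and that wedge products
   satisfy the usual Leibniz rule. *)
Definition ext_d w : cochain := fun s =>
  \sum_(i < size s) (-1) ^+ i * s`_i (w (drop_nth i s)) +
  \sum_(i < size s) \sum_(j < size s | (i < j)%N)
    (-1) ^+ (i + j) *
    w (lie_bracket s`_i s`_j :: drop_nth i (drop_nth j s)).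

(* The Lie derivative, computed with L_X (iota_Y w) - iota_[X,Y] w =
   iota_Y (L_X w). *)
Fixpoint lie_der X w s : A :=
  if s is Y :: s' then
    lie_der X (contract Y w) s' - w (lie_bracket X Y :: s')
  else X (w [::]).


Lemma multilinearD w s1 s2 X Y : multilinear w ->
  w (s1 ++ (X + Y) :: s2) = w (s1 ++ X :: s2) + w (s1 ++ Y :: s2).
Proof. by move=> wL; have := wL s1 s2 1 X Y; rewrite scale1r mul1r. Qed.

Lemma multilinear0 w s1 s2 : multilinear w -> w (s1 ++ 0 :: s2) = 0.
Proof.
move=> wL; apply: (addrI (w (s1 ++ 0 :: s2))).
by rewrite -multilinearD// !addr0.
Qed.

Lemma multilinearZ w s1 s2 a X : multilinear w ->
  w (s1 ++ (a *: X) :: s2) = a * w (s1 ++ X :: s2).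
Proof.
by move=> wL; rewrite -[a *: X]addr0 wL multilinear0// addr0.
Qed.

Lemma multilinear_contract X w : multilinear w -> multilinear (contract X w).
Proof. by move=> wL s1 s2 a Y Z; exact: (wL (X :: s1)). Qed.

Lemma alternating_contract X w : alternating w -> alternating (contract X w).
Proof. by move=> wA s us; apply: wA => /=; rewrite negb_and us orbT. Qed.

Lemma adjacent_swap w s1 s2 X Y : multilinear w ->
  (forall Z, w (s1 ++ Z :: Z :: s2) = 0) ->
  w (s1 ++ X :: Y :: s2) = - w (s1 ++ Y :: X :: s2).
Proof.
move=> wL wA; have := wA (X + Y).
rewrite multilinearD// -!(cat_rcons _ s1) !multilinearD// !cat_rcons.
by rewrite !wA add0r addr0 => /eqP; rewrite addr_eq0 => /eqP.
Qed.

Lemma form_swap w s1 s2 X Y : multilinear w -> alternating w ->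
  w (s1 ++ X :: Y :: s2) = - w (s1 ++ Y :: X :: s2).
Proof.
move=> wL wA; apply: adjacent_swap => // Z; apply: wA.
by rewrite cat_uniq/= !inE eqxx/= !andbF.
Qed.

Lemma adjacent_alternating w : multilinear w ->
  (forall s1 s2 Z, w (s1 ++ Z :: Z :: s2) = 0) -> alternating w.
Proof.
move=> wL wA.
have move2 s1 X s2 s3 : w (s1 ++ X :: s2 ++ X :: s3) = 0.
  elim: s2 s1 => [|Y s2 IH] s1 /=; first exact: wA.
  rewrite adjacent_swap//; apply/eqP; rewrite oppr_eq0.
  by rewrite -(cat_rcons Y) IH.
move=> s; have : w s = w ([::] ++ s) by [].
move: [::] => s1; rewrite -[RHS]/(w (s1 ++ s)) => ->.
elim: s s1 => // X s IH s1 /=; rewrite negb_and negbK => /orP[|us].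
  by move=> /path.splitPr[s2 s3]; exact: move2.
by rewrite -cat_rcons IH.
Qed.

Lemma lie_der_comb X a w1 w2 s :
  lie_der X (fun t => a * w1 t + w2 t) s =
  a * lie_der X w1 s + X a * w1 s + lie_der X w2 s.
Proof.
elim: s w1 w2 => [|Y s IH] w1 w2 /=; first by rewrite vfD vfM; ring.
have -> : contract Y (fun t => a * w1 t + w2 t) =
  (fun t => a * contract Y w1 t + contract Y w2 t) by [].
by rewrite IH /contract; ring.
Qed.

Lemma lie_der_sub X w1 w2 s :
  lie_der X (fun t => w1 t - w2 t) s = lie_der X w1 s - lie_der X w2 s.
Proof.
have -> : (fun t => w1 t - w2 t) = (fun t => -1 * w2 t + w1 t).
  by apply: funext => t; ring.
rewrite lie_der_comb.
have -> : X (-1) = 0.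
  rewrite vfN; have := vfM X 1 1; rewrite mulr1 !mul1r => /eqP.
  by rewrite -{1}[X 1]addr0 (can_eq (addKr _)) => /eqP <-; rewrite oppr0.
by ring.
Qed.

Lemma lie_der_multilinear X w : multilinear w -> multilinear (lie_der X w).
Proof.
move=> wL s1; elim: s1 w wL => [|T s1 IH] w wL s2 a Y Z /=.
  have -> : contract (a *: Y + Z) w =
      (fun t => a * contract Y w t + contract Z w t).
    by apply: funext => t; exact: (wL [::]).
  rewrite lie_der_comb lie_bracket_linr (wL [::]) (wL [::])/=.
  by rewrite /contract; ring.
rewrite IH; last exact: multilinear_contract.
by rewrite (wL (_ :: s1)); ring.
Qed.

Lemma lie_der_alternating X w : multilinear w -> alternating w ->
  alternating (lie_der X w).
Proof.
move=> wL wA; apply: adjacent_alternating; first exact: lie_der_multilinear.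
move=> s1; elim: s1 w wL wA => [|T s1 IH] w wL wA s2 Z /=.
  have -> : contract Z (contract Z w) = fun=> 0.
    by apply: funext => t; apply: wA; rewrite /= inE eqxx.
  rewrite /contract (form_swap [::] _ _ Z)//= addrK.
  elim: s2 => [|U s2 /= ->]; first exact: vf0.
  by rewrite subrr.
rewrite IH; [|exact: multilinear_contract|exact: alternating_contract].
rewrite sub0r wA ?oppr0//= cat_uniq/= !inE eqxx/= !andbF//.
Qed.

Lemma lie_derE X w s : multilinear w -> alternating w ->
  lie_der X w s = X (w s) -
    \sum_(j < size s) (-1) ^+ j * w (lie_bracket X s`_j :: drop_nth j s).
Proof.
elim: s w => [|Y s IH] w wL wA /=; first by rewrite big_ord0 subr0.
rewrite IH; [|exact: multilinear_contract|exact: alternating_contract].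
rewrite big_ord_recl/= expr0 mul1r /drop_nth /= ?take0 ?drop0 /contract.
rewrite (eq_bigr (fun i : 'I_(size s) => (-1) ^+ bump 0 i *
  w [:: lie_bracket X s`_i, Y & (take i s ++ drop i.+1 s)])); last first.
  move=> i _; rewrite (form_swap [::] _ Y)//= /bump/= add1n exprS; ring.
by ring.
Qed.

Lemma ext_d_cons X w s : multilinear w -> alternating w ->
  ext_d w (X :: s) = lie_der X w s - ext_d (contract X w) s.
Proof.
move=> wL wA; rewrite lie_derE// /ext_d /=.
rewrite big_ord_recl/= expr0 mul1r drop_nth0.
rewrite [\sum_(i < (size s).+1) _]big_ord_recl/=.
rewrite [\sum_(j < (size s).+1 | _) _]big_mkcond big_ord_recl/= add0r.
rewrite (eq_bigr (fun i : 'I_(size s) => - ((-1) ^+ i *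
   s`_i (contract X w (drop_nth i s))))); last first.
  by move=> i _; rewrite /= exprS mulN1r mulNr.
rewrite [X in _ + (X + _)](eq_bigr (fun j : 'I_(size s) => - ((-1) ^+ j *
   w (lie_bracket X s`_j :: drop_nth j s)))); last first.
  by move=> j _; rewrite /= add0n exprS mulN1r mulNr drop_nth0.
rewrite [X in _ + (_ + X)](eq_bigr (fun i : 'I_(size s) => -
   \sum_(j < size s | (i < j)%N) (-1) ^+ (i + j) *
    contract X w (lie_bracket s`_i s`_j :: drop_nth i (drop_nth j s)))); last first.
  move=> i _; rewrite big_mkcond big_ord_recl/= add0r -sumrN [RHS]big_mkcond/=.
  apply: eq_bigr => j _; rewrite /bump/= !add1n ltnS; case: ifP => // _.
  rewrite addSn addnS !exprS /contract (form_swap [::] _ X)//=.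
  rewrite /drop_nth/=; ring.
rewrite !sumrN; ring.
Qed.

Lemma ext_d_nil w : ext_d w [::] = 0.
Proof. by rewrite /ext_d !big_ord0 addr0. Qed.

Lemma ext_d_lin (c : R) w1 w2 : ext_d (c *: w1 + w2) = c *: ext_d w1 + ext_d w2.
Proof.
apply: funext => s; rewrite /ext_d.
have E t : (c *: w1 + w2) t = c *: w1 t + w2 t by [].
have -> : (c *: ext_d w1 + ext_d w2) s = c *: ext_d w1 s + ext_d w2 s by [].
rewrite scalerDr addrACA; congr (_ + _); rewrite scaler_sumr -big_split/=.
  by apply: eq_bigr => i _; rewrite E vfD vfZ mulrDr scaler_mulr.
apply: eq_bigr => i _; rewrite scaler_sumr -big_split/=.
by apply: eq_bigr => j _; rewrite E mulrDr scaler_mulr.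
Qed.

Lemma ext_d_sub w1 w2 s :
  ext_d (fun t => w1 t - w2 t) s = ext_d w1 s - ext_d w2 s.
Proof.
have -> : (fun t => w1 t - w2 t) = (-1 : R) *: w2 + w1.
  by apply: funext => t; rewrite scaleN1r addrC.
by rewrite ext_d_lin scaleN1r addrC.
Qed.

(* [wedge1 a w] is da /\ w. *)
Fixpoint wedge1 a w s : A :=
  if s is Y :: s' then Y a * w s' - wedge1 a (contract Y w) s' else 0.

Lemma wedge1N a w s : wedge1 a (fun t => - w t) s = - wedge1 a w s.
Proof.
elim: s w => [|Y s IH] w /=; first by rewrite oppr0.
have -> : contract Y (fun t => - w t) = (fun t => - contract Y w t) by [].
by rewrite IH; ring.
Qed.

Lemma contractC X Y w : multilinear w -> alternating w ->
  contract X (contract Y w) = (fun t => - contract Y (contract X w) t).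
Proof.
by move=> wL wA; apply: funext => t; rewrite /contract (form_swap [::] _ Y).
Qed.

Lemma ext_d_comb a w1 w2 s : multilinear w1 -> alternating w1 ->
  multilinear w2 -> alternating w2 ->
  ext_d (fun t => a * w1 t + w2 t) s =
  a * ext_d w1 s + wedge1 a w1 s + ext_d w2 s.
Proof.
elim: s w1 w2 => [|Y s IH] w1 w2 L1 A1 L2 A2 /=.
  by rewrite !ext_d_nil; ring.
have L : multilinear (fun t => a * w1 t + w2 t).
  by move=> s1 s2 b T U; rewrite L1 L2; ring.
have H : alternating (fun t => a * w1 t + w2 t).
  by move=> t ut; rewrite A1// A2// mulr0 addr0.
rewrite !ext_d_cons// lie_der_comb.
have -> : contract Y (fun t => a * w1 t + w2 t) =
  (fun t => a * contract Y w1 t + contract Y w2 t) by [].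
rewrite IH; [ring|exact: multilinear_contract|exact: alternating_contract
  |exact: multilinear_contract|exact: alternating_contract].
Qed.

Lemma lie_der_vf_comb a X Y w s : multilinear w -> alternating w ->
  lie_der (a *: X + Y) w s =
  a * lie_der X w s + wedge1 a (contract X w) s + lie_der Y w s.
Proof.
elim: s w => [|T s IH] w wL wA /=.
  by rewrite -[LHS]/(a * X (w [::]) + Y (w [::])); ring.
rewrite IH; [|exact: multilinear_contract|exact: alternating_contract].
rewrite lie_bracket_linl !(wL [::])/= contractC// wedge1N /contract; ring.
Qed.

Lemma ext_d_multilinear w : multilinear w -> alternating w ->
  multilinear (ext_d w).
Proof.
move=> wL wA s1; elim: s1 w wL wA => [|T s1 IH] w wL wA s2 a X Y.
  rewrite /= !ext_d_cons//.
  have -> : contract (a *: X + Y) w =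
      (fun t => a * contract X w t + contract Y w t).
    by apply: funext => t; exact: (wL [::]).
  rewrite lie_der_vf_comb// ext_d_comb; first ring;
    do ?[exact: multilinear_contract|exact: alternating_contract].
rewrite /= !ext_d_cons// lie_der_multilinear// IH; first ring;
  do ?[exact: multilinear_contract|exact: alternating_contract].
Qed.

Lemma ext_d0 : ext_d (fun=> 0) = (fun=> 0).
Proof.
apply: funext => s; rewrite /ext_d !big1 ?addr0// => i _.
  by rewrite big1// => j _; rewrite mulr0.
by rewrite vf0 mulr0.
Qed.

Lemma ext_d_alternating w : multilinear w -> alternating w ->
  alternating (ext_d w).
Proof.
move=> wL wA; apply: adjacent_alternating; first exact: ext_d_multilinear.
move=> s1; elim: s1 w wL wA => [|T s1 IH] w wL wA s2 Z /=; last first.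
  rewrite ext_d_cons// IH; do ?[exact: multilinear_contract|exact: alternating_contract].
  rewrite subr0 lie_der_alternating// cat_uniq/= !inE eqxx/= !andbF//.
have cL := multilinear_contract Z wL; have cA := alternating_contract Z wA.
have c0 : contract Z (contract Z w) = fun=> 0.
  by apply: funext => t; apply: wA; rewrite /= inE eqxx.
rewrite ext_d_cons// ext_d_cons//= c0 ext_d0 lie_bracketxx.
by rewrite (multilinear0 [::])//; ring.
Qed.

Lemma lie_der_lie X Y w s : multilinear w ->
  lie_der (lie_bracket X Y) w s =
  lie_der X (lie_der Y w) s - lie_der Y (lie_der X w) s.
Proof.
elim: s w => [|Z s IH] w wL; first by [].
have cE U T : contract T (lie_der U w) =
  (fun t => lie_der U (contract T w) t - contract (lie_bracket U T) w t) by [].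
rewrite /= !cE !lie_der_sub IH; last exact: multilinear_contract.
rewrite (lie_jacobi X Y Z) /contract.
by rewrite (multilinearD [::])//=; ring.
Qed.

Lemma ext_d_lie_der X w s : multilinear w -> alternating w ->
  ext_d (lie_der X w) s = lie_der X (ext_d w) s.
Proof.
elim: s w => [|Y s IH] w wL wA /=; first by rewrite !ext_d_nil vf0.
have cL Z := multilinear_contract Z wL.
have cA Z := alternating_contract Z wA.
rewrite !ext_d_cons//; [|exact: lie_der_multilinear|exact: lie_der_alternating].
have -> : contract Y (lie_der X w) =
  (fun t => lie_der X (contract Y w) t - contract (lie_bracket X Y) w t) by [].
have -> : contract Y (ext_d w) =
    (fun t => lie_der Y w t - ext_d (contract Y w) t).
  by apply: funext => t; exact: ext_d_cons.
by rewrite ext_d_sub IH// lie_der_sub lie_der_lie//; ring.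
Qed.

Lemma ext_dK w : multilinear w -> alternating w -> ext_d (ext_d w) = fun=> 0.
Proof.
move=> wL wA; apply: funext => s.
elim: s w wL wA => [|Y s IH] w wL wA; first exact: ext_d_nil.
rewrite ext_d_cons; [|exact: ext_d_multilinear|exact: ext_d_alternating].
have -> : contract Y (ext_d w) =
    (fun t => lie_der Y w t - ext_d (contract Y w) t).
  by apply: funext => t; exact: ext_d_cons.
rewrite ext_d_sub ext_d_lie_der// IH; first ring.
  exact: multilinear_contract.
exact: alternating_contract.
Qed.

Lemma is_form_contract k X w : is_form k.+1 w -> is_form k (contract X w).
Proof.
case=> wL wA w0; split.
- exact: multilinear_contract.
- exact: alternating_contract.
- by move=> s sk; exact: w0.
Qed.

Lemma is_form_contracts k s w :
  is_form (size s + k) w -> is_form k (contracts s w).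
Proof.
elim: s k => [|X s IH] k //=; rewrite addSnnS => /IH; exact: is_form_contract.
Qed.

Lemma is_form_ext_d k w : is_form k w -> is_form k.+1 (ext_d w).
Proof.
case=> wL wA w0; split.
- exact: ext_d_multilinear.
- exact: ext_d_alternating.
have sz (i : nat) (s : seq V) : (i < size s)%N -> size (drop_nth i s) = (size s).-1.
  move=> si; rewrite size_cat size_take si size_drop.
  by rewrite -[in RHS](subnKC si) addSn.
move=> s sk; rewrite /ext_d !big1 ?addr0// => i _.
  rewrite big1// => j ij; rewrite w0 ?mulr0//=.
  rewrite sz sz//; first by case: (size s) i j ij sk => [[]//|[|p]] //= i j;
     case: i j => [[|?]//= ?] [[|?]//= ?].
  rewrite -ltnS prednK; first exact: leq_trans (ltn_ord j).
  exact: leq_ltn_trans (leq0n _) (ltn_ord j).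
rewrite w0 ?vf0 ?mulr0// sz//.
by case: (size s) i sk => [[]|].
Qed.

Lemma ext_d_hamiltonian_bracket k X Y w (b c : cochain) : is_form k w -> ext_d w = 0 ->
  multilinear b -> alternating b -> ext_d b = - contract X w ->
  multilinear c -> alternating c -> ext_d c = - contract Y w ->
  ext_d (contract X (contract Y w)) = contract (lie_bracket X Y) w.
Proof.
move=> [wL wA _] dw bL bA db cL cA dc; apply: funext => s.
have dd Z e : multilinear e -> alternating e -> ext_d e = - contract Z w ->
    forall t, ext_d (contract Z w) t = 0.
  move=> eL eA de t; have -> : contract Z w = (-1 : R) *: ext_d e + 0.
    by rewrite de scaleN1r opprK addr0.
  by rewrite ext_d_lin ext_dK// (_ : ext_d 0 = 0) ?ext_d0// scaler0 addr0.
have lX t : lie_der X w t = 0.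
  by apply/eqP; rewrite -[lie_der X w t](subrK (ext_d (contract X w) t))
    -ext_d_cons// dw (dd X b)// addr0.
have := ext_d_cons X s (multilinear_contract Y wL) (alternating_contract Y wA).
rewrite (dd Y c)// => /esym/eqP; rewrite subr_eq0 => /eqP <-.
have := lX (Y :: s) => /= /eqP; rewrite subr_eq0 => /eqP ->.
by [].
Qed.

End Forms.

(* A Z-graded vector space with finitely many nonzero components, given by the
   projections onto its components. *)
Record graded_space (R : fieldType) := GradedSpace {
  gs_sort :> lmodType R;
  gs_index : finType;
  gs_deg : gs_index -> int;
  gs_proj : gs_index -> gs_sort -> gs_sort;
  gs_deg_inj : injective gs_deg;
  gs_proj_linear : forall j, linear (gs_proj j);
  gs_proj_proj : forall i j x,
    gs_proj i (gs_proj j x) = if i == j then gs_proj j x else 0;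
  gs_proj_sum : forall x, \sum_j gs_proj j x = x
}.

Section VectorValuedForms.
Variables (R : fieldType) (E : graded_space R).

(* A formal sum of vector valued forms is a function on sequences: its k-form
   component is its restriction to the sequences of size k. *)
Local Notation vvcochain := (seq E -> E).
Implicit Types (K L N mu : vvcochain) (s : seq E) (x y : E) (a b d : int).

Definition homogeneous d x :=
  forall j : gs_index E, gs_deg j != d -> gs_proj j x = 0.

Definition vv_multilinear K := forall s1 s2 (c : R) x y,
  K (s1 ++ (c *: x + y) :: s2) = c *: K (s1 ++ x :: s2) + K (s1 ++ y :: s2).

Definition graded_symmetric K := forall s1 s2 a b x y,
  homogeneous a x -> homogeneous b y ->
  K (s1 ++ x :: y :: s2) = (-1) ^ (a * b) *: K (s1 ++ y :: x :: s2).

Definition has_degree d K := forall s (ds : seq int),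
  size ds = size s ->
  (forall i, (i < size s)%N -> homogeneous ds`_i s`_i) ->
  homogeneous (\sum_(a <- ds) a + d) (K s).

Definition vvform d K :=
  [/\ vv_multilinear K, graded_symmetric K & has_degree d K].

Definition unshuffle (k p : nat) (sigma : 'S_p) : bool :=
  [forall i : 'I_p, forall j : 'I_p, (i < j)%N && ((j < k)%N || (k <= i)%N) ==>
                       (sigma i < sigma j)%N].

Definition koszul_sign (p : nat) (deg : 'I_p -> int) (sigma : 'S_p) : R :=
  \prod_(i < p) \prod_(j < p | (i < j)%N && (sigma j < sigma i)%N)
    (-1) ^ (deg (sigma i) * deg (sigma j)).

(* The Koszul sign only makes sense on homogeneous arguments, so [insertion K L]
   is extended multilinearly: [delta] ranges over the choices of a homogeneous
   component of each argument. The sum over [k] accounts for all the components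
   of the formal sum [K]; the matching component of [L] has arity
   [size s - k + 1 > 0]. *)
Definition insertion K L : vvcochain := fun s =>
  \sum_(delta : {ffun 'I_(size s) -> gs_index E})
  \sum_(k < (size s).+1)
  \sum_(sigma : 'S_(size s) | unshuffle k sigma)
    let t := [seq gs_proj (delta (sigma j)) s`_(sigma j)
             | j <- enum 'I_(size s)] in
    koszul_sign (fun j => gs_deg (delta j)) sigma *: L (K (take k t) :: drop k t).

(* The bracket of (formal sums of) forms [K] of degree [a] and [L] of degree
   [b]. *)
Definition RN a b K L : vvcochain :=
  insertion K L - (-1) ^ (a * b) *: insertion L K.

Definition nijenhuis mu N K :=
  [/\ vvform 1 mu, vvform 0 N, vvform 0 K,
      RN 0 1 N (RN 0 1 N mu) = RN 0 1 K mu
    & RN 0 0 N K = 0].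

Definition euler : vvcochain := fun s =>
  if s is [:: x] then \sum_j (- gs_deg j)%:~R *: gs_proj j x else 0.

End VectorValuedForms.

Section Plectic.
Variables (R : realType) (m : nat) (M : manifold R m).
Local Notation A := (smooth_fun M).
Local Notation V := (vector_field M).
Local Notation cochain := (seq V -> A).

Record diff_form (k : nat) := DiffForm {
  df_val :> cochain; df_form : is_form k df_val }.

(* The value at [p] of a vector field [X] is the tangent vector [f |-> X f p].
   Every tangent vector at [p] and every tuple of tangent vectors extend to
   vector fields, so that [plectic_nondegenerate] is the nondegeneracy of
   [plectic_form] on each tangent space. *)
Record plectic (n : nat) := Plectic {
  plectic_form :> diff_form n.+1;
  plectic_closed : ext_d plectic_form = 0;
  plectic_nondegenerate : forall (p : M) (X : V),
    (forall s, contract X plectic_form s p = 0) -> forall f, X f p = 0 }.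

Variables (n : nat) (omega : plectic n).

(* The component of degree k of an inhomogeneous form. *)
Definition form_part (k : nat) (w : cochain) : cochain :=
  fun s => if size s == k then w s else 0.

Definition hamiltonian (w : cochain) (X : V) := ext_d w = - contract X omega.

(* E is the space of the inhomogeneous forms with components of degrees
   0, ..., n - 1 the last of which is Hamiltonian; E_(-j) is its part of form
   degree n - j. For n = 0, E is zero whatever the last condition. *)
Definition lie_pred : {pred cochain} := [pred w : cochain | `[<
  [/\ multilinear w, alternating w, forall s, (n <= size s)%N -> w s = 0
    & exists X, hamiltonian (form_part n.-1 w) X] >]].

Lemma multilinear_lin (c : R) (w1 w2 : cochain) :
  multilinear w1 -> multilinear w2 -> multilinear (c *: w1 + w2).
Proof.
move=> L1 L2 s1 s2 a X Y.
have E s : (c *: w1 + w2) s = c *: w1 s + w2 s by [].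
by rewrite !E L1 L2 scalerDr mulrDr scaler_mulr addrACA.
Qed.

Lemma alternating_lin (c : R) (w1 w2 : cochain) :
  alternating w1 -> alternating w2 -> alternating (c *: w1 + w2).
Proof.
move=> A1 A2 s us.
have -> : (c *: w1 + w2) s = c *: w1 s + w2 s by [].
by rewrite A1// A2// scaler0 addr0.
Qed.

Lemma form_part_lin k (c : R) (w1 w2 : cochain) :
  form_part k (c *: w1 + w2) = c *: form_part k w1 + form_part k w2.
Proof.
apply: funext => s.
have -> : (c *: form_part k w1 + form_part k w2) s =
  c *: form_part k w1 s + form_part k w2 s by [].
by rewrite /form_part; case: ifP => // _; rewrite scaler0 addr0.
Qed.

Lemma hamiltonian0 w X : ext_d w = 0 -> X = 0 -> hamiltonian w X.
Proof.
move=> dw ->; rewrite /hamiltonian dw; apply: funext => s.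
have [wL _ _] := df_form omega.
rewrite -[RHS]/(- omega ([::] ++ 0 :: s)) multilinear0//.
by rewrite oppr0.
Qed.

Lemma lie_pred_submod : submod_closed lie_pred.
Proof.
split.
  apply/asboolP; split=> [s1 s2 a X Y|//|//|].
    by rewrite -[RHS]/(a * 0 + 0 : A) mulr0 addr0.
  exists 0; apply: hamiltonian0 => //.
  rewrite (_ : form_part _ _ = fun=> 0) ?ext_d0//.
  by apply: funext => s; rewrite /form_part; case: ifP.
move=> c w1 w2 /asboolP[L1 A1 S1 [X1 H1]] /asboolP[L2 A2 S2 [X2 H2]].
apply/asboolP; split.
- exact: multilinear_lin.
- exact: alternating_lin.
- move=> s ns; have -> : (c *: w1 + w2) s = c *: w1 s + w2 s by [].
  by rewrite S1// S2// scaler0 addr0.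
- exists ((c *: (1 : A)) *: X1 + X2).
  rewrite /hamiltonian form_part_lin ext_d_lin H1 H2; apply: funext => s.
  have [oL _ _] := df_form omega.
  rewrite -[RHS]/(- omega ([::] ++ (c *: (1 : A) *: X1 + X2) :: s)) oL/=.
  by rewrite -smooth_scaler_mul mul1r opprD -scalerN.
Qed.

Record lie_space := LieSpace {
  lie_val :> cochain; _ : lie_val \in lie_pred }.

HB.instance Definition _ := [isSub for lie_val].
HB.instance Definition _ := [Choice of lie_space by <:].
HB.instance Definition _ := GRing.SubChoice_isSubLmodule.Build R cochain
  _ lie_space (GRing.submod_closed_semi lie_pred_submod).

Lemma lie_spaceP (x : lie_space) :
  [/\ multilinear x, alternating x, forall s, (n <= size s)%N -> x s = 0
    & exists X, hamiltonian (form_part n.-1 x) X].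
Proof. by apply/asboolP; case: x. Qed.

Lemma multilinear_form_part k (w : cochain) :
  multilinear w -> multilinear (form_part k w).
Proof.
move=> wL s1 s2 a X Y; rewrite /form_part !size_cat/= wL.
by case: ifP => // _; rewrite mulr0 addr0.
Qed.

Lemma alternating_form_part k (w : cochain) :
  alternating w -> alternating (form_part k w).
Proof. by move=> wA s us; rewrite /form_part wA//; case: ifP. Qed.

Lemma form_part_form_part k l (w : cochain) :
  form_part k (form_part l w) = if k == l then form_part l w else 0.
Proof.
case: (eqVneq k l) => [->|kl]; apply: funext => s; rewrite /form_part.
  by case: (size s == l).
have [->|//] := eqVneq (size s) k.
by rewrite (negbTE kl).
Qed.

Fact lie_part_subproof (j : 'I_n) (x : lie_space) :
  form_part (n - j.+1) x \in lie_pred.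
Proof.
have [xL xA x0 [X HX]] := lie_spaceP x; apply/asboolP; split.
- exact: multilinear_form_part.
- exact: alternating_form_part.
- by move=> s ns; rewrite /form_part x0//; case: ifP.
- rewrite form_part_form_part; case: eqP => [<-|_]; first by exists X.
  by exists 0; apply: hamiltonian0 => //; exact: ext_d0.
Qed.

Definition lie_part (j : 'I_n) (x : lie_space) : lie_space :=
  LieSpace (lie_part_subproof j x).

Definition lie_deg (j : 'I_n) : int := - (j.+1)%:Z.

Fact lie_deg_inj : injective lie_deg.
Proof. by move=> i j /oppr_inj[] /ord_inj. Qed.

Fact lie_part_linear j : linear (lie_part j).
Proof. by move=> c x y; apply: val_inj; exact: form_part_lin. Qed.

Fact lie_part_part i j x :
  lie_part i (lie_part j x) = if i == j then lie_part j x else 0.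
Proof.
apply: val_inj; rewrite /= form_part_form_part.
have -> : (n - i.+1 == n - j.+1)%N = (i == j).
  apply/eqP/eqP => [e|->//]; apply: ord_inj; apply: succn_inj.
  by rewrite -(subKn (ltn_ord i)) e subKn.
by case: ifP.
Qed.

Fact lie_part_sum x : \sum_j lie_part j x = x.
Proof.
apply: val_inj; apply: funext => s.
have -> : val (\sum_j lie_part j x) s =
    \sum_(j < n) form_part (n - j.+1) x s.
  by elim/big_rec2 : _ => // j y1 y2 _ <-.
have [sn|ns] := ltnP (size s) n; last first.
  have [_ _ x0 _] := lie_spaceP x; rewrite big1 => [|j _].
    by rewrite [RHS]x0.
  by rewrite /form_part x0//; case: ifP.
have jn : (n - (size s).+1 < n)%N by rewrite ltn_subrL; case: n sn.
rewrite (bigD1 (Ordinal jn))//= big1 ?addr0 => [|j /eqP ji].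
  by rewrite /form_part subnSK// subKn ?eqxx// ltnW.
rewrite /form_part; case: eqP => // e; case: ji; apply: ord_inj => /=.
by rewrite e subnSK// subKn// ltnW.
Qed.

Definition lie_graded : graded_space R := @GradedSpace R lie_space 'I_n lie_deg
  lie_part lie_deg_inj lie_part_linear lie_part_part lie_part_sum.

(* The Hamiltonian vector field of the component of [x] in E_(-1). *)
Definition ham_vf (x : lie_space) : V :=
  xget 0 (hamiltonian (form_part n.-1 x)).

Lemma ham_vfP (x : lie_space) : hamiltonian (form_part n.-1 x) (ham_vf x).
Proof. by have [_ _ _ [X HX]] := lie_spaceP x; exact: (xgetI 0 HX). Qed.

Lemma contractsE s (w : cochain) t : contracts s w t = w (catrev s t).
Proof. by elim: s t => //= X s IH t; rewrite /contract IH. Qed.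

Lemma multilinear_contracts s (w : cochain) :
  multilinear w -> multilinear (contracts s w).
Proof. by move=> wL; elim: s => //= X s IH; exact: multilinear_contract. Qed.

Lemma alternating_contracts s (w : cochain) :
  alternating w -> alternating (contracts s w).
Proof. by move=> wA; elim: s => //= X s IH; exact: alternating_contract. Qed.

Lemma contracts_size k s (w : cochain) t :
  is_form k w -> (size s + size t)%N != k -> contracts s w t = 0.
Proof. by case=> _ _ w0 sk; rewrite contractsE w0// catrevE size_cat size_rev. Qed.

(* The components of degree < -1 are sent to (-1)^|x| dx, and that of degree -1
   to 0. *)
Fact lie_l1_subproof (x : lie_space) :
  (\sum_(j < n | lie_deg j != -1)
     (-1 : R) ^ lie_deg j *: ext_d (lie_part j x)) \in lie_pred.
Proof.
have [C0 CL] := lie_pred_submod.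
apply: (big_ind (fun w => w \in lie_pred)) => //.
  by move=> w1 w2 H1 H2; rewrite -(scale1r w1); exact: CL.
move=> j j0; rewrite -[_ *: _]addr0; apply: CL => //.
have [xL xA _ _] := lie_spaceP (lie_part j x).
have xj s : size s != (n - j.+1)%N -> lie_part j x s = 0.
  by rewrite /= /form_part => /negbTE ->.
have [dL dA d0] : is_form (n - j.+1).+1 (ext_d (lie_part j x)).
  exact: is_form_ext_d.
have jn := ltn_ord j; have {}j0 : (0 < j)%N.
  by rewrite lt0n; apply: contraNneq j0 => j0; rewrite /lie_deg j0.
apply/asboolP; split=> //.
  move=> s ns; apply: d0; rewrite neq_ltn; apply/orP; right.
  by rewrite subnSK// (leq_trans _ ns)// ltn_subrL j0 (leq_trans _ jn).
exists 0; apply: hamiltonian0 => //.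
have dd := ext_dK xL xA.
case: (eqVneq (n - j)%N n.-1) => [e|e].
  rewrite (_ : form_part _ _ = ext_d (lie_part j x))//; apply: funext => s.
  by rewrite /form_part; case: eqP => // /eqP se; rewrite d0// subnSK// e.
rewrite (_ : form_part _ _ = fun=> 0) ?ext_d0//; apply: funext => s.
rewrite /form_part; case: eqP => // se; rewrite d0// subnSK// se eq_sym//.
Qed.

Definition lie_l1 (x : lie_space) : lie_space := LieSpace (lie_l1_subproof x).

Definition lie_sign (k : nat) : R :=
  (-1) ^+ (if odd k then k.-1./2 else (k./2).+1).

Definition ham_contracts (xs : seq lie_space) (w : cochain) : cochain :=
  contracts [seq ham_vf x | x <- xs] w.

Fact lie_lk_subproof (xs : seq lie_space) :
  (if (1 < size xs)%N then lie_sign (size xs) *: ham_contracts xs omega else 0)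
  \in lie_pred.
Proof.
have [C0 CL] := lie_pred_submod; case: ifP => // k1.
rewrite -[_ *: _]addr0; apply: CL => //.
have oF := df_form omega; have [oL oA o0] := oF.
apply/asboolP; split; [exact: multilinear_contracts|exact: alternating_contracts| |].
  move=> t nt; apply: contracts_size oF _; rewrite size_map neq_ltn.
  by apply/orP; right; rewrite -addn2 addnC leq_add.
have [xs2|xs2] := eqVneq (size xs) 2.
  case: xs k1 xs2 => [|x [|y []]]// _ _.
  rewrite (_ : form_part _ _ = ham_contracts [:: x; y] omega).
    exists (- lie_bracket (ham_vf x) (ham_vf y)).
    have [xL xA _ _] := lie_spaceP x; have [yL yA _ _] := lie_spaceP y.
    rewrite /hamiltonian (ext_d_hamiltonian_bracket oF (plectic_closed omega)
     (multilinear_form_part _ xL) (alternating_form_part _ xA) (ham_vfP x)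
     (multilinear_form_part _ yL) (alternating_form_part _ yA) (ham_vfP y)).
    apply: funext => s.
    rewrite -[RHS]/(- omega ([::] ++ - lie_bracket (ham_vf x) (ham_vf y) :: s)).
    by rewrite -[- lie_bracket _ _]scaleN1r multilinearZ// mulN1r opprK.
  apply: funext => t; rewrite /form_part; case: eqP => // tn.
  rewrite /ham_contracts (contracts_size oF)//.
  by apply/eqP => -[e]; apply: tn; rewrite -e.
exists 0; apply: hamiltonian0 => //.
rewrite (_ : form_part _ _ = fun=> 0) ?ext_d0//; apply: funext => t.
rewrite /form_part; case: eqP => // tn; apply: contracts_size oF _.
rewrite size_map tn; apply/eqP; case: (n) => [|p]/=.
  by rewrite addn0 => e; rewrite e in k1.
by move=> /eqP; rewrite -[p.+2]add2n eqn_add2r (negbTE xs2).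
Qed.

(* By multilinearity the arguments of l_k may be inhomogeneous; only their
   components in E_(-1) contribute when k >= 2. *)
Definition lie_l (k : nat) : seq lie_graded -> lie_graded := fun xs =>
  if size xs == k then
    if xs is [:: x] then lie_l1 x else LieSpace (lie_lk_subproof xs)
  else 0.

Definition lie_mu : seq lie_graded -> lie_graded :=
  \sum_(1 <= k < n.+2) lie_l k.

Fact eta_tilde_subproof (eta : diff_form n) (xs : seq lie_space) :
  (if (1 < size xs)%N then ham_contracts xs eta else 0) \in lie_pred.
Proof.
have [C0 _] := lie_pred_submod; case: ifP => // k1.
have eF := df_form eta; have [eL eA e0] := eF.
apply/asboolP; split; [exact: multilinear_contracts|exact: alternating_contracts| |].
  move=> t nt; apply: contracts_size eF _; rewrite size_map neq_ltn.
  apply/orP; right; rewrite -[n]add0n.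
  by rewrite -addSn leq_add// ltnW.
exists 0; apply: hamiltonian0 => //.
rewrite (_ : form_part _ _ = fun=> 0) ?ext_d0//; apply: funext => t.
rewrite /form_part; case: eqP => // tn; apply: contracts_size eF _.
rewrite size_map tn neq_ltn; apply/orP; right.
case: (n) => [|p]/=; first by rewrite addn0 ltnW.
by rewrite -[p.+2]add2n leq_add2r.
Qed.

(* For i < 2, iota_chi1 ... iota_chii eta need not be in E, and [eta_tilde] is
   the junk value 0. *)
Definition eta_tilde (eta : diff_form n) (i : nat) :
    seq lie_graded -> lie_graded := fun xs =>
  if size xs == i then LieSpace (eta_tilde_subproof eta xs) else 0.

End Plectic.

Arguments euler {R} E s.
Arguments lie_l {R m M n} omega k xs.
Arguments lie_mu {R m M n} omega xs.
Arguments eta_tilde {R m M n} omega eta i xs.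

(* Main.v *)
Require Import Defs.
From mathcomp Require Import all_boot all_order fingroup perm all_algebra.
From mathcomp Require Import boolp classical_sets functions reals.
From mathcomp Require Import zify.

(* The Euler map S acts through the bracket by the degree: [S, L] = d L for L of
   degree d. This needs L graded symmetric, also when L is itself a bracket,
   whence the symmetry of insertions below. Everything else follows from two
   properties of the arguments with zero Hamiltonian vector field: eta~_i and the
   l_k with k >= 2 vanish on them, while eta~_i, l_1 (exact forms) and the l_k
   with k >= 3 (forms of degree < n - 1) take their values among them. So
   [eta~_i, l_k] = 0 for k >= 3, [eta~_i, eta~_i] = 0, and [eta~_i, mu], being
   l_1 o eta~_i minus the insertion of l_2 into eta~_i, has both properties, so
   that [eta~_i, [eta~_i, mu]] = 0. *)

Set Implicit Arguments.
Unset Strict Implicit.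
Unset Printing Implicit Defensive.
Import GRing.Theory.
Local Open Scope ring_scope.

(** * Koszul signs and unshuffles under adjacent transpositions *)

(** The square comes from a binomial: let D be the bracket with eta~_i. Since S acts as the identity
    on forms of degree 1, bracketing twice with S + eta~_i is (1 + D)^2 = 1 + 2D on [mu] as soon as
    D^2 [mu] = 0, and 1 + 2D is the bracket with S + 2 eta~_i. By non-degeneracy, an element of E
    has zero Hamiltonian vector field exactly when its component of form degree n - 1 is closed; its
    lower components are unconstrained. Contracting eta with i fields gives form degree n - i, at
    most n - 2 as i >= 2; contracting omega with k fields gives n + 1 - k, at most n - 2 only from k
    = 3 on. For k = 2 the value has form degree n - 1 and, up to sign, a Lie bracket as Hamiltonian
    vector field, which is why l_2 stays in the deformed structure; l_1 stays because it does not
    vanish on the arguments in question. Graded symmetry is a condition on neighbouring arguments,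
    so Koszul signs only have to be followed under adjacent transpositions. *)

Section AdjacentTranspositions.
Variables (R : fieldType) (p : nat) (i i' : 'I_p).
Hypothesis ii' : i' = i.+1 :> nat.
Local Notation tau := (tperm i i').
Implicit Types (sigma : 'S_p) (d : 'I_p -> int).

(** No ordinal lies strictly between [i] and [i'], so only their own pair changes order. *)
Lemma tperm_ltn a b : (a, b) != (i, i') -> (a, b) != (i', i) ->
  (tau a < tau b)%N = (a < b)%N.
Proof.
rewrite !xpair_eqE -!val_eqE /=.
case: tpermP => [->|->|/eqP + /eqP +]; case: tpermP => [->|->|/eqP + /eqP +];
  rewrite -?val_eqE /=; lia.
Qed.

(** Only the factors at the pair of [i] and [i'] differ. Exactly one of [r i i'] and [r i' i] holds,
    so a factor [w i i'] appears or disappears, which is the same since it is its own inverse. Both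
    sign rules below take an inversion relation for [r], read on values or on positions. *)
Lemma prod_tperm_inversions (w : 'I_p -> 'I_p -> R) (r : rel 'I_p) :
  (forall a b, w a b = w b a) -> w i i' * w i i' = 1 -> r i i' = ~~ r i' i ->
  \prod_(a : 'I_p) \prod_(b : 'I_p | (tau a < tau b)%N && r a b) w a b =
  w i i' * \prod_(a : 'I_p) \prod_(b : 'I_p | (a < b)%N && r a b) w a b.
Proof.
move=> wC ww rr; have ne : (i', i) != (i, i') by rewrite xpair_eqE -!val_eqE /=; lia.
rewrite !pair_big_dep /= !(big_mkcond (fun _ => _ && _)) /=.
rewrite (bigD1 (i, i')) //= (bigD1 (i', i)) //=.
rewrite [in RHS](bigD1 (i, i')) //= [in RHS](bigD1 (i', i)) //=.
rewrite !tpermL !tpermR.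
have -> : (i' < i)%N = false by lia.
have -> : (i < i')%N by lia.
rewrite rr /= mul1r mul1r (eq_bigr (fun q : 'I_p * 'I_p =>
  if (q.1 < q.2)%N && r q.1 q.2 then w q.1 q.2 else 1)); last first.
  by move=> [a b] /andP[h1 h2] /=; rewrite tperm_ltn.
by case: (r i' i); rewrite /= !mulrA ?ww ?mulr1 ?mul1r // (wC i').
Qed.

Lemma sign_square (m : int) : (-1 : R) ^ m * (-1) ^ m = 1.
Proof. by rewrite -expfzMl mulrNN mul1r exp1rz. Qed.

(** Indexing the inversions by values instead of positions suits [sigma * tau], where [tau] acts on
    the values. *)
Lemma koszul_sign_values d sigma : koszul_sign R d sigma =
  \prod_(a : 'I_p) \prod_(b : 'I_p | (a < b)%N && ((sigma^-1)%g b < (sigma^-1)%g a)%N)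
     (-1) ^ (d a * d b).
Proof.
rewrite /koszul_sign (exchange_big_dep predT) //=.
rewrite [RHS](reindex_inj (@perm_inj _ sigma)) /=; apply: eq_bigr => a _.
rewrite [RHS](reindex_inj (@perm_inj _ sigma)) /=; apply: eq_big => b.
  by rewrite !permK andbC.
by rewrite mulrC.
Qed.

(** The reordered word of degrees is the same on both sides; the word it starts from has its
    neighbours [i] and [i'] exchanged. *)
Lemma koszul_sign_tperm_values d sigma :
  koszul_sign R (d \o tau) (sigma * tau)%g =
  (-1) ^ (d i * d i') * koszul_sign R d sigma.
Proof.
rewrite !koszul_sign_values -prod_tperm_inversions.
- rewrite (reindex_inj (@perm_inj _ tau)) /=; apply: eq_bigr => a _.
  rewrite (reindex_inj (@perm_inj _ tau)) /=; apply: eq_big => b.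
    by rewrite invMg !permM tpermV !tpermK.
  by rewrite !tpermK.
- by move=> a b; rewrite mulrC.
- exact: sign_square.
- rewrite -leqNgt [RHS]leq_eqVlt; case: eqP => [e|//].
  by have {}e := perm_inj (val_inj e); move: ii'; rewrite e; lia.
Qed.

(** Here the starting word is kept, and the reordered one has its neighbours at positions [i] and
    [i'] exchanged. *)
Lemma koszul_sign_tperm_positions d sigma :
  koszul_sign R d (tau * sigma)%g =
  (-1) ^ (d (sigma i) * d (sigma i')) * koszul_sign R d sigma.
Proof.
rewrite /koszul_sign
  -(@prod_tperm_inversions (fun a b => (-1) ^ (d (sigma a) * d (sigma b)))
     (fun a b => (sigma b < sigma a)%N)).
- rewrite (reindex_inj (@perm_inj _ tau)) /=; apply: eq_bigr => a _.
  rewrite (reindex_inj (@perm_inj _ tau)) /=; apply: eq_big => b.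
    by rewrite !permM !tpermK.
  by rewrite !permM !tpermK.
- by move=> a b; rewrite mulrC.
- exact: sign_square.
- rewrite -leqNgt [RHS]leq_eqVlt; case: eqP => [e|//].
  by have {}e := perm_inj (val_inj e); move: ii'; rewrite e; lia.
Qed.

(** The arguments [i] and [i'] both go to the inner form, or both stay with the outer one. *)
Definition same_block (k : nat) sigma :=
  ((sigma^-1)%g i < k)%N == ((sigma^-1)%g i' < k)%N.

Lemma unshuffleP k sigma : reflect
  (forall a b : 'I_p, (a < b)%N -> (b < k)%N || (k <= a)%N -> (sigma a < sigma b)%N)
  (unshuffle k sigma).
Proof.
apply: (iffP forallP) => [H a b ab kk|H a].
  by have /forallP/(_ b) := H a; rewrite ab kk.
by apply/forallP => b; apply/implyP => /andP[]; exact: H.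
Qed.

Lemma unshuffle_tperm k sigma : ~~ same_block k sigma ->
  unshuffle k sigma -> unshuffle k (sigma * tau)%g.
Proof.
move=> nb /unshuffleP us; apply/unshuffleP => a b ab kk.
have := us a b ab kk; rewrite !permM.
have [e _|n1] := eqVneq (sigma a, sigma b) (i, i').
  case: e => ea eb; move: nb; rewrite /same_block -ea -eb !permK; lia.
have [e _|n2] := eqVneq (sigma a, sigma b) (i', i).
  case: e => ea eb; move: nb; rewrite /same_block -ea -eb !permK; lia.
by rewrite tperm_ltn.
Qed.

Lemma same_block_tperm k sigma : same_block k (sigma * tau)%g = same_block k sigma.
Proof. by rewrite /same_block invMg !permM tpermV tpermL tpermR eq_sym. Qed.

Lemma unshuffle_same_block k sigma : unshuffle k sigma -> same_block k sigma ->
  (sigma^-1)%g i' = ((sigma^-1)%g i).+1 :> nat.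
Proof.
move=> /unshuffleP us; rewrite /same_block.
set a := (sigma^-1)%g i; set b := (sigma^-1)%g i' => /eqP sb.
have sa : sigma a = i by rewrite permKV.
have sb' : sigma b = i' by rewrite permKV.
have [ab|ba|/ord_inj ab] := ltngtP a b; last first.
- by move: sa; rewrite ab sb' => /(congr1 val) /=; lia.
- by have := us b a ba; rewrite sa sb'; lia.
(* A position strictly between [a] and [b] would belong to their block, hence carry a value strictly
   between [i] and its successor [i']. *)
apply/eqP; rewrite eqn_leq ab andbT leqNgt; apply/negP => ab1.
have cp : (a.+1 < p)%N by apply: leq_trans (ltn_ord b); lia.
have h1 := us a (Ordinal cp) (ltnSn _); have h2 := us (Ordinal cp) b ab1.
rewrite sa /= in h1; rewrite sb' /= in h2; move: (ltn_ord b) h1 h2; lia.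
Qed.

End AdjacentTranspositions.

Section EnumOrdinals.
Variable p : nat.

Lemma enum_split (j : 'I_p) :
  exists s1 s2, [/\ enum 'I_p = s1 ++ j :: s2, size s1 = j, j \notin s1 & j \notin s2].
Proof.
have jE : j \in enum 'I_p by rewrite mem_enum.
have ij := index_enum_ord j; have uE := enum_uniq 'I_p.
move: (enum 'I_p) jE ij uE => s /path.splitPr[s1 s2] ij.
rewrite cat_uniq /= => /and3P[_ /norP[j1 _] /andP[j2 _]].
exists s1, s2; split => //.
by move: ij; rewrite index_cat (negbTE j1) /= eqxx addn0.
Qed.

End EnumOrdinals.

Section Adjacent.
Variables (p : nat) (i i' : 'I_p).
Hypothesis ii' : i' = i.+1 :> nat.

Lemma enum_split_adjacent : exists s1 s2,
  [/\ enum 'I_p = s1 ++ i :: i' :: s2, size s1 = i &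
      forall j, (j \in s1) || (j \in s2) -> tperm i i' j = j].
Proof.
have [s1 [s2 [e s1i i1 i2]]] := enum_split i.
have := nth_ord_enum i i'.
rewrite {1}e nth_cat s1i ii' ltnNge leqnSn /= subSnn /=.
case: s2 e i2 => [|j s2] e i2 /= ji.
  by move: ii'; rewrite -ji; lia.
rewrite ji in e i2; exists s1, s2; split => // k.
have := enum_uniq 'I_p; rewrite e cat_uniq /= => /and3P[_].
rewrite !negb_or => /and3P[_ i'1 _] /and3P[_ i'2 _].
move: i2; rewrite inE negb_or => /andP[_ i2].
by case/orP => kj; rewrite tpermD // eq_sym; [apply: (memPn i1)|apply: (memPn i'1)|
  apply: (memPn i2)|apply: (memPn i'2)].
Qed.

End Adjacent.

(** * Insertions and brackets of vector valued forms *)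

Section Multilinear.
Variables (R : fieldType) (E : graded_space R).
Local Notation vvcochain := (seq E -> E).
Implicit Types (G K L : vvcochain) (k : nat).

Lemma vv_multilinear0 G s1 s2 : vv_multilinear G -> G (s1 ++ 0 :: s2) = 0.
Proof.
move=> H; have := H s1 s2 1 0 0; rewrite !scale1r add0r => /eqP.
by rewrite -{1}[G _]addr0 (inj_eq (addrI _)) => /eqP <-.
Qed.

Lemma vv_multilinearD G s1 s2 x y : vv_multilinear G ->
  G (s1 ++ (x + y) :: s2) = G (s1 ++ x :: s2) + G (s1 ++ y :: s2).
Proof. by move=> H; rewrite -[x]scale1r H !scale1r. Qed.

Lemma vv_multilinearZ G s1 s2 c x : vv_multilinear G ->
  G (s1 ++ (c *: x) :: s2) = c *: G (s1 ++ x :: s2).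
Proof. by move=> H; rewrite -[c *: x]addr0 H vv_multilinear0 // addr0. Qed.

Lemma vv_multilinear_sum G s1 s2 (I : finType) (F : I -> E) : vv_multilinear G ->
  G (s1 ++ (\sum_j F j) :: s2) = \sum_j G (s1 ++ F j :: s2).
Proof.
move=> H; elim/big_ind2 : _ => //; first exact: vv_multilinear0.
by move=> x1 x2 y1 y2 <- <-; rewrite vv_multilinearD.
Qed.

(** The permuted arguments of an insertion form a family over ['I_p], where a slot is an index
    rather than a splitting of the list. *)
Lemma vv_multilinear_ord G p (j : 'I_p) (z z1 z2 : 'I_p -> E) (c : R) :
  vv_multilinear G -> z j = c *: z1 j + z2 j ->
  (forall a, a != j -> z1 a = z a /\ z2 a = z a) ->
  G [seq z a | a <- enum 'I_p] =
  c *: G [seq z1 a | a <- enum 'I_p] + G [seq z2 a | a <- enum 'I_p].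
Proof.
move=> H zj zE; have [s1 [s2 [-> _ j1 j2]]] := enum_split j.
rewrite !map_cat /= zj H.
have e s : j \notin s -> map z1 s = map z s /\ map z2 s = map z s.
  move=> js; split; apply/eq_in_map => a sa;
    by have /zE[] : a != j by apply: contraNneq js => <-.
by have [-> ->] := e s1 j1; have [-> ->] := e s2 j2.
Qed.

Lemma vv_multilinear_ord0 G p (j : 'I_p) (z : 'I_p -> E) :
  vv_multilinear G -> z j = 0 -> G [seq z a | a <- enum 'I_p] = 0.
Proof.
move=> H zj; have [s1 [s2 [-> _ j1 j2]]] := enum_split j.
by rewrite !map_cat /= zj vv_multilinear0.
Qed.

Definition insert_term K L k : vvcochain := fun t => L (K (take k t) :: drop k t).

Lemma insert_term_multilinear K L k : vv_multilinear K -> vv_multilinear L ->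
  vv_multilinear (insert_term K L k).
Proof.
move=> KL LL s1 s2 c x y; rewrite /insert_term !take_cat !drop_cat.
case: ltnP => ks; first exact: (LL (_ :: _)).
case: (k - size s1)%N => [|n] /=; first by rewrite !cats0; exact: (LL [:: _]).
by rewrite KL; exact: (LL [::]).
Qed.

Lemma insert_term_swap K L k s1 s2 a b x y :
  graded_symmetric K -> vv_multilinear L -> graded_symmetric L ->
  homogeneous a x -> homogeneous b y -> (size s1).+1 != k ->
  insert_term K L k (s1 ++ x :: y :: s2) =
  (-1) ^ (a * b) *: insert_term K L k (s1 ++ y :: x :: s2).
Proof.
move=> KS LL LS hx hy sk; rewrite /insert_term !take_cat !drop_cat.
case: ltnP => ks; first exact: (LS (_ :: _)).
(* The middle case, a cut between [x] and [y], is the one excluded by hypothesis. *)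
case e : (k - size s1)%N => [|[|n]] /=; first by rewrite !cats0; exact: (LS [:: _]).
  by move: sk; lia.
by rewrite (KS _ _ a b) // (vv_multilinearZ [::]).
Qed.

(** [delta] and [z] are separate families, so that a transposition of the arguments acts on both by
    composition. *)
Definition unshuffle_sum K L k p (delta : 'I_p -> gs_index E) (z : 'I_p -> E) : E :=
  \sum_(sigma : 'S_p | unshuffle k sigma)
    koszul_sign R (fun j => gs_deg (delta j)) sigma *:
    insert_term K L k [seq gs_proj (delta (sigma j)) (z (sigma j)) | j <- enum 'I_p].

Lemma insertionE K L s p : size s = p -> insertion K L s =
  \sum_(delta : {ffun 'I_p -> gs_index E}) \sum_(k < p.+1)
    unshuffle_sum K L k delta (fun j => s`_j).
Proof. by move=> <-. Qed.


Lemma proj_homogeneous j x : homogeneous (gs_deg j) (gs_proj j x : E).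
Proof. by move=> a /eqP aj; rewrite gs_proj_proj; case: eqP => // e; rewrite e in aj. Qed.

(* Composing with the transposition of [i] and [i'] permutes the unshuffles having
   [i] and [i'] in different blocks; for the others, [i] and [i'] are adjacent in a
   block and the symmetry of [K] or [L] applies. *)
Lemma unshuffle_sum_swap K L k p (i i' : 'I_p) (delta : 'I_p -> gs_index E) z :
  i' = i.+1 :> nat -> graded_symmetric K -> vv_multilinear L -> graded_symmetric L ->
  unshuffle_sum K L k delta z =
  (-1) ^ (gs_deg (delta i) * gs_deg (delta i')) *:
  unshuffle_sum K L k (delta \o tperm i i') (z \o tperm i i').
Proof.
move=> ii' KS LL LS; set tau := tperm i i'; set eps := _ ^ _.
rewrite /unshuffle_sum scaler_sumr (bigID (same_block i i' k)) /=.
rewrite [RHS](bigID (same_block i i' k)) /=; congr (_ + _); last first.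
  rewrite [RHS](reindex_inj (mulIg tau)) /=; apply: eq_big => sigma.
    rewrite same_block_tperm andbC [RHS]andbC.
    case: (boolP (same_block _ _ _ _)) => //= nb.
    apply/idP/idP; first exact: unshuffle_tperm.
    rewrite -{2}[sigma]mulg1 -(tperm2 i i') mulgA; apply: unshuffle_tperm => //.
    by rewrite same_block_tperm.
  move=> _.
  have := koszul_sign_tperm_values R ii' (fun j => gs_deg (delta j)) sigma.
  rewrite /comp => ->.
  rewrite scalerA mulrA sign_square mul1r; congr (_ *: insert_term _ _ _ _).
  by apply: eq_map => j; rewrite permM tpermK.
apply: eq_bigr => sigma /andP[us sb].
have ab := unshuffle_same_block ii' us sb.
set a := (sigma^-1)%g i in ab; set b := (sigma^-1)%g i' in ab.
have sa : sigma a = i by rewrite permKV.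
have sb' : sigma b = i' by rewrite permKV.
(* As [i] and [i'] stand at the adjacent positions [a] and [b], exchanging the values amounts to
   exchanging the positions. *)
have st : (tperm a b * sigma = sigma * tau)%g.
  by rewrite conjgC tpermJ sa sb'.
(* The rules on values and on positions, both applied to [sigma * tau], contribute the same factor
   and cancel. All of [eps] therefore comes from the symmetry of [K] or [L] at [a] and [b]. *)
have -> : koszul_sign R (fun j => gs_deg (delta (tau j))) sigma =
          koszul_sign R (fun j => gs_deg (delta j)) sigma.
  have := koszul_sign_tperm_values R ii' (fun j => gs_deg (delta j)) (sigma * tau)%g.
  rewrite -mulgA tperm2 mulg1 /comp => ->.
  rewrite -st koszul_sign_tperm_positions // sa sb' mulrA sign_square.
  by rewrite mul1r.
rewrite scalerA mulrC -scalerA; congr (_ *: _).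
have [s1 [s2 [-> s1a fix12]]] := enum_split_adjacent ab.
rewrite !map_cat /= sa sb' /= /tau tpermL tpermR.
rewrite (insert_term_swap _ KS LL LS (@proj_homogeneous _ _)
  (@proj_homogeneous _ _)); last first.
  rewrite size_map s1a; move: sb; rewrite /same_block -/a -/b; lia.
have fx s : {subset s <= s1 ++ s2} ->
    [seq gs_proj (delta (sigma j)) (z (sigma j)) | j <- s] =
    [seq gs_proj (delta (tau (sigma j))) (z (tau (sigma j))) | j <- s].
  move=> ss; apply/eq_in_map => j /ss; rewrite mem_cat => /fix12 tj.
  by rewrite -permM -st permM tj.
by rewrite !fx // => j; rewrite mem_cat => ->; rewrite ?orbT.
Qed.

End Multilinear.

Section Insertion.
Variables (R : fieldType) (E : graded_space R).
Local Notation vvcochain := (seq E -> E).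
Implicit Types (G K L : vvcochain) (k : nat) (x y : E).

Lemma unshuffle_sum_linear K L k p (j : 'I_p) (delta : 'I_p -> gs_index E)
    (z z1 z2 : 'I_p -> E) (c : R) :
  vv_multilinear K -> vv_multilinear L -> z j = c *: z1 j + z2 j ->
  (forall a, a != j -> z1 a = z a /\ z2 a = z a) ->
  unshuffle_sum K L k delta z =
  c *: unshuffle_sum K L k delta z1 + unshuffle_sum K L k delta z2.
Proof.
move=> KL LL zj zE; rewrite /unshuffle_sum scaler_sumr -big_split /=.
apply: eq_bigr => sigma _.
rewrite (@vv_multilinear_ord _ _ (insert_term K L k) p ((sigma^-1)%g j) _
  (fun a => gs_proj (delta (sigma a)) (z1 (sigma a)))
  (fun a => gs_proj (delta (sigma a)) (z2 (sigma a))) c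
  (insert_term_multilinear _ KL LL)).
- by rewrite scalerDr !scalerA mulrC.
- by rewrite permKV zj gs_proj_linear.
- move=> a aj; have /zE[-> ->] // : sigma a != j.
  by apply: contraNneq aj => <-; rewrite permK.
Qed.

Lemma insertion_multilinear K L : vv_multilinear K -> vv_multilinear L ->
  vv_multilinear (insertion K L).
Proof.
move=> KL LL s1 s2 c x y; set p := size (s1 ++ x :: s2).
have jp : (size s1 < p)%N by rewrite /p size_cat /= -addSnnS leq_addr.
have eq_p u : size (s1 ++ u :: s2) = p by rewrite /p !size_cat.
rewrite !(insertionE _ _ (eq_p _)) scaler_sumr -big_split /=; apply: eq_bigr => delta _.
rewrite scaler_sumr -big_split /=; apply: eq_bigr => k _.
apply: (@unshuffle_sum_linear _ _ _ _ (Ordinal jp)) => //=.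
  by rewrite !nth_cat ltnn subnn.
move=> a; rewrite -val_eqE /= => aj; rewrite !nth_cat; case: ltnP => // ja.
by rewrite (_ : (a - size s1)%N = (a - size s1).-1.+1) //; move: aj ja; lia.
Qed.

Lemma unshuffle_sum0 K L k p (j : 'I_p) (delta : 'I_p -> gs_index E) z :
  vv_multilinear K -> vv_multilinear L -> gs_proj (delta j) (z j) = 0 ->
  unshuffle_sum K L k delta z = 0.
Proof.
move=> KL LL zj; apply: big1 => sigma _.
rewrite (@vv_multilinear_ord0 _ _ _ _ ((sigma^-1)%g j)) ?scaler0 //.
  exact: insert_term_multilinear.
by rewrite permKV.
Qed.

Lemma insertion_symmetric K L : vv_multilinear K -> graded_symmetric K ->
  vv_multilinear L -> graded_symmetric L -> graded_symmetric (insertion K L).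
Proof.
move=> KL KS LL LS s1 s2 a b x y hx hy; set p := size (s1 ++ x :: y :: s2).
have jp : (size s1 < p)%N by rewrite /p size_cat /= -addSnnS leq_addr.
have jp' : ((size s1).+1 < p)%N by rewrite /p size_cat /= -2!addSnnS leq_addr.
set j := Ordinal jp; set j' := Ordinal jp'.
have eq_p u v : size (s1 ++ u :: v :: s2) = p by rewrite /p !size_cat.
rewrite !(insertionE _ _ (eq_p _ _)).
(* The component chosen for an argument has to follow it through the transposition. *)
rewrite (reindex_inj (h := fun delta : {ffun 'I_p -> gs_index E} =>
  [ffun q => delta (tperm j j' q)])) /=; last first.
  move=> d1 d2 /ffunP e; apply/ffunP => q; have := e (tperm j j' q).
  by rewrite !ffunE tpermK.
rewrite scaler_sumr; apply: eq_bigr => delta _.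
rewrite scaler_sumr; apply: eq_bigr => k _.
pose z (q : 'I_p) := nth 0 (s1 ++ x :: y :: s2) q.
pose z' (q : 'I_p) := nth 0 (s1 ++ y :: x :: s2) q.
rewrite -/z -/z'.
have zE q : z q = z' (tperm j j' q).
  rewrite /z /z' !nth_cat; case: tpermP => [->|->|/eqP + /eqP +] /=.
  - by rewrite ltnn ltnNge leqnSn subnn subSnn.
  - by rewrite ltnn ltnNge leqnSn subnn subSnn.
  rewrite -!val_eqE /= => qj qj'; case: ltnP => // jq.
  by rewrite (_ : (q - size s1)%N = (q - size s1).-2.+2) //; move: qj qj' jq; lia.
have zj : z j = x by rewrite /z nth_cat ltnn subnn.
have zj' : z j' = y by rewrite /z nth_cat ltnNge leqnSn subSnn.
have -> : z = z' \o tperm j j' by apply: funext.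
set d := (X in unshuffle_sum K L k X); have {d}-> : d = delta \o tperm j j'.
  by apply: funext => q; rewrite /d ffunE.
rewrite (@unshuffle_sum_swap _ _ K L k p j j') //=.
rewrite tpermL tpermR.
have -> : (delta \o tperm j j') \o tperm j j' = delta.
  by apply: funext => q /=; rewrite tpermK.
have -> : (z' \o tperm j j') \o tperm j j' = z'.
  by apply: funext => q /=; rewrite tpermK.
(* The sign depends on [delta]. It is the wanted one if [delta] selects degree [a] for [x] and [b]
   for [y]; any other choice projects one of them to zero. *)
have [->|/hx da] := eqVneq (gs_deg (delta j')) a; last first.
  rewrite (@unshuffle_sum0 _ _ _ _ j') ?scaler0 //.
  by rewrite -(tpermL j j') -zE zj tpermL.
have [->//|/hy db] := eqVneq (gs_deg (delta j)) b.
rewrite (@unshuffle_sum0 _ _ _ _ j) ?scaler0 //.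
by rewrite -(tpermR j j') -zE zj' tpermR.
Qed.

Lemma gs_proj0 j : gs_proj j (0 : E) = 0.
Proof.
have := gs_proj_linear j 1 (0 : E) 0; rewrite !scale1r add0r => /eqP.
by rewrite -{1}[gs_proj j _]addr0 (inj_eq (addrI _)) => /eqP <-.
Qed.

Lemma homogeneous_comb d c x y :
  homogeneous d x -> homogeneous d y -> homogeneous d (c *: x + y).
Proof. by move=> hx hy j jd; rewrite gs_proj_linear hx // hy // scaler0 addr0. Qed.

Lemma homogeneous0 d : homogeneous d (0 : E).
Proof. by move=> j _; exact: gs_proj0. Qed.

Lemma homogeneousD d x y : homogeneous d x -> homogeneous d y -> homogeneous d (x + y).
Proof. by move=> hx hy; rewrite -[x]scale1r; exact: homogeneous_comb. Qed.

Lemma homogeneousZ d c x : homogeneous d x -> homogeneous d (c *: x).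
Proof.
by move=> hx; rewrite -[_ *: _]addr0; apply: homogeneous_comb => //; exact: homogeneous0.
Qed.

Lemma insert_term_degree a b K L k : has_degree a K -> has_degree b L ->
  has_degree (a + b) (insert_term K L k).
Proof.
move=> hK hL s ds dss hs; rewrite /insert_term.
have -> : \sum_(c <- ds) c + (a + b) =
    \sum_(c <- (\sum_(c <- take k ds) c + a) :: drop k ds) c + b.
  by rewrite -{1}(cat_take_drop k ds) big_cat big_cons /= addrA (addrAC _ _ a).
apply: hL; first by rewrite /= !size_drop dss.
case=> [_|q]/=.
  apply: hK; first by rewrite !size_take dss.
  move=> q; rewrite size_take_min => qk; rewrite !nth_take; do ?lia.
  by apply: hs; lia.
rewrite ltnS size_drop => qk; rewrite !nth_drop; apply: hs; lia.
Qed.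

Lemma insertion_degree a b K L : vv_multilinear K -> vv_multilinear L ->
  has_degree a K -> has_degree b L -> has_degree (a + b) (insertion K L).
Proof.
move=> KL LL hK hL s ds dss hs; rewrite (insertionE _ _ (erefl (size s))).
have hsum (I : finType) (P : pred I) (F : I -> E) d :
    (forall i, P i -> homogeneous d (F i)) -> homogeneous d (\sum_(i | P i) F i).
  by move=> hF; apply: big_ind => //; [exact: homogeneous0|exact: homogeneousD].
apply: (hsum) => delta _; apply: (hsum) => k _.
(* Either [delta] selects the degrees [ds], or it projects some argument to zero. *)
have [dE|[j jd]] : (forall j, gs_deg (delta j) = ds`_j) \/
    exists j, gs_deg (delta j) != ds`_j.
  case: (pselect (exists j, gs_deg (delta j) != ds`_j)) => [|ne]; first by right.
  by left=> j; apply/eqP; apply: contra_notT ne; exists j.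
- apply: (hsum) => sigma _; apply: homogeneousZ.
  have -> : \sum_(c <- ds) c =
      \sum_(c <- [seq gs_deg (delta (sigma j)) | j <- enum 'I_(size s)]) c.
    rewrite big_map big_enum /= (big_nth 0) big_mkord dss.
    by rewrite (reindex_inj (@perm_inj _ sigma)) /=; apply: eq_bigr => j _; rewrite dE.
  apply: insert_term_degree => //; first by rewrite !size_map.
  move=> q; rewrite size_map size_enum_ord => qs.
  rewrite !(nth_map (Ordinal qs)) -?enumT ?size_enum_ord //.
  exact: proj_homogeneous.
- rewrite (@unshuffle_sum0 _ _ _ _ j) //; first exact: homogeneous0.
  exact: hs.
Qed.

Lemma insertion_vvform a b K L : vvform a K -> vvform b L ->
  vvform (a + b) (insertion K L).
Proof.
move=> [KL KS KD] [LL LS LD]; split.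
- exact: insertion_multilinear.
- exact: insertion_symmetric.
- exact: insertion_degree.
Qed.

Lemma vvform_comb d c K L : vvform d K -> vvform d L -> vvform d (c *: K + L).
Proof.
have cE s : (c *: K + L) s = c *: K s + L s by [].
move=> [KL KS KD] [LL LS LD]; split.
- by move=> s1 s2 e x y; rewrite !cE KL LL !scalerDr !scalerA [e * c]mulrC addrACA.
- move=> s1 s2 a b x y hx hy; rewrite !cE (KS _ _ a b) // (LS _ _ a b) //.
  by rewrite scalerDr !scalerA mulrC.
- by move=> s ds dss hs; rewrite cE; apply: homogeneous_comb; [exact: KD|exact: LD].
Qed.

Lemma vvform0 d : vvform d (0 : vvcochain).
Proof.
have zE s : (0 : vvcochain) s = 0 by [].
split=> [s1 s2 c x y|s1 s2 a b x y _ _|s ds _ _]; rewrite !zE ?scaler0 ?addr0 //.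
exact: homogeneous0.
Qed.

Lemma vvformD d K L : vvform d K -> vvform d L -> vvform d (K + L).
Proof. by move=> hK hL; rewrite -[K]scale1r; exact: vvform_comb. Qed.

Lemma vvformZ d c K : vvform d K -> vvform d (c *: K).
Proof.
by move=> hK; rewrite -[_ *: _]addr0; apply: vvform_comb => //; exact: vvform0.
Qed.

Lemma RN_vvform a b K L : vvform a K -> vvform b L -> vvform (a + b) (RN a b K L).
Proof.
move=> hK hL; rewrite /RN -scaleNr [X in vvform _ X]addrC.
apply: vvform_comb; last exact: insertion_vvform.
by rewrite addrC; exact: insertion_vvform.
Qed.

Lemma insertion_combr K c L1 L2 :
  insertion K (c *: L1 + L2) = c *: insertion K L1 + insertion K L2.
Proof.
apply: funext => s; rewrite -[RHS]/(c *: insertion K L1 s + insertion K L2 s).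
rewrite /insertion scaler_sumr -big_split /=; apply: eq_bigr => delta _.
rewrite scaler_sumr -big_split /=; apply: eq_bigr => k _.
rewrite scaler_sumr -big_split /=; apply: eq_bigr => sigma _.
by rewrite scalerDr !scalerA [_ * c]mulrC.
Qed.

Lemma insertion_combl c K1 K2 L : vv_multilinear L ->
  insertion (c *: K1 + K2) L = c *: insertion K1 L + insertion K2 L.
Proof.
move=> LL; apply: funext => s.
rewrite -[RHS]/(c *: insertion K1 L s + insertion K2 L s).
rewrite /insertion scaler_sumr -big_split /=; apply: eq_bigr => delta _.
rewrite scaler_sumr -big_split /=; apply: eq_bigr => k _.
rewrite scaler_sumr -big_split /=; apply: eq_bigr => sigma _.
by rewrite (LL [::]) scalerDr !scalerA [_ * c]mulrC.
Qed.

Lemma RN_combr a b K c L1 L2 : vv_multilinear K ->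
  RN a b K (c *: L1 + L2) = c *: RN a b K L1 + RN a b K L2.
Proof.
move=> KL; rewrite /RN insertion_combr insertion_combl //.
by rewrite !scalerDr scalerN !scalerA [_ * c]mulrC opprD addrACA.
Qed.

Lemma RN_combl a b c K1 K2 L : vv_multilinear L ->
  RN a b (c *: K1 + K2) L = c *: RN a b K1 L + RN a b K2 L.
Proof.
move=> LL; rewrite /RN insertion_combr insertion_combl //.
by rewrite !scalerDr scalerN !scalerA [_ * c]mulrC opprD addrACA.
Qed.

Lemma RNDr a b K L1 L2 : vv_multilinear K ->
  RN a b K (L1 + L2) = RN a b K L1 + RN a b K L2.
Proof. by move=> KL; rewrite -[L1]scale1r RN_combr // !scale1r. Qed.

Lemma RNDl a b K1 K2 L : vv_multilinear L ->
  RN a b (K1 + K2) L = RN a b K1 L + RN a b K2 L.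
Proof. by move=> KL; rewrite -[K1]scale1r RN_combl // !scale1r. Qed.

Lemma RN0E b K L : RN 0 b K L = insertion K L - insertion L K.
Proof. by rewrite /RN mul0r expr0z scale1r. Qed.

Lemma RN00C K L : RN 0 0 K L = - RN 0 0 L K.
Proof. by rewrite !RN0E opprB. Qed.

End Insertion.

(** * Unshuffles whose first block is a singleton or everything *)

Lemma increasing_image_inj q (f g : 'I_q -> nat) :
  {homo f : a b / (a < b)%N} -> {homo g : a b / (a < b)%N} ->
  (forall a, exists b, g b = f a) -> (forall a, exists b, f b = g a) -> f =1 g.
Proof.
(* Where the maps agree below [k], [f1 k] is some [g1 m], and [m] is not below [k] because [f1]
   already takes those values earlier. Applied in both directions, this gives equality at [k]. *)
have le (f1 g1 : 'I_q -> nat) (k : 'I_q) :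
    {homo f1 : a b / (a < b)%N} -> {homo g1 : a b / (a < b)%N} ->
    (forall a, exists b, g1 b = f1 a) ->
    (forall a : 'I_q, (a < k)%N -> f1 a = g1 a) -> (g1 k <= f1 k)%N.
  move=> fI gI gf e; have [m] := gf k.
  have [mk|km|mk] := ltngtP m k; last by rewrite (ord_inj mk) => ->.
    by rewrite -e // => fe; have := fI _ _ mk; rewrite fe ltnn.
  by move=> <-; exact/ltnW/gI.
move=> fI gI gf fg k; have [n] := ubnP (val k); elim: n k => // n IH k kn.
have e (a : 'I_q) : (a < k)%N -> f a = g a.
  by move=> ak; apply: IH; apply: leq_trans ak _; rewrite -ltnS.
by apply/eqP; rewrite eqn_leq; apply/andP; split; apply: le => // a /e.
Qed.

Lemma unshuffle_all p (sigma : 'S_p) : unshuffle p sigma = (sigma == 1%g).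
Proof.
apply/idP/eqP => [/unshuffleP us|->]; last first.
  by apply/unshuffleP => a b ab _; rewrite !perm1.
apply/permP => a; rewrite perm1; apply: ord_inj.
apply: (@increasing_image_inj _ (fun b => sigma b) (fun b => b)) => //.
- by move=> c d cd; apply: us => //; rewrite ltn_ord.
- by move=> c; exists (sigma c).
- by move=> c; exists ((sigma^-1)%g c); rewrite permKV.
Qed.

Lemma ltn_lift q (j : 'I_q.+1) (a b : 'I_q) : (lift j a < lift j b)%N = (a < b)%N.
Proof. by rewrite /= /bump; lia. Qed.

(** [lift_perm ord0 j 1] brings [j] to the front and keeps the order of the others. With the next
    lemma, [j] parametrizes all the unshuffles with a singleton first block. *)
Lemma unshuffle1_lift_perm q (j : 'I_q.+1) : unshuffle 1 (lift_perm ord0 j 1%g).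
Proof.
apply/unshuffleP => a b.
case: (unliftP ord0 a) => [a'|] ->; last by rewrite ltnS; case: b => -[].
case: (unliftP ord0 b) => [b'|] -> //.
by rewrite !lift_perm_lift !perm1 !ltn_lift.
Qed.

Lemma unshuffle1_inv q (sigma : 'S_q.+1) : unshuffle 1 sigma ->
  lift_perm ord0 (sigma ord0) 1%g = sigma.
Proof.
move=> /unshuffleP us; apply/permP => a.
case: (unliftP ord0 a) => [k|] ->; last by rewrite lift_perm_id.
rewrite lift_perm_lift perm1; apply: ord_inj.
apply: (@increasing_image_inj _ (fun b => lift (sigma ord0) b)
  (fun b => sigma (lift ord0 b))) => [c d|c d cd|c|c].
- by rewrite ltn_lift.
- by apply: us; rewrite ?ltn_lift // orbT.
- case: (unliftP ord0 ((sigma^-1)%g (lift (sigma ord0) c))) => [b|] e.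
    by exists b; rewrite -e permKV.
  have := neq_lift (sigma ord0) c; rewrite -{1}e permKV eqxx //.
- case: (unliftP (sigma ord0) (sigma (lift ord0 c))) => [b|] e.
    by exists b; rewrite e.
  by have := neq_lift ord0 c; rewrite -(inj_eq (@perm_inj _ sigma)) e eqxx.
Qed.

(** Allows an induction on [j] in which each step is an adjacent transposition, with a known
    sign. *)
Lemma lift_perm_step q (j j' : 'I_q.+1) : j' = j.+1 :> nat ->
  lift_perm ord0 j' 1%g = (lift_perm ord0 j 1 * tperm j j')%g.
Proof.
move=> jj'; apply/permP => a; rewrite permM.
case: (unliftP ord0 a) => [k|] ->; last by rewrite !lift_perm_id tpermL.
rewrite !lift_perm_lift perm1; apply: ord_inj.
have := ltn_ord k; have := ltn_ord j'.
case: tpermP => [/(congr1 val)|/(congr1 val)|/eqP + /eqP +];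
  rewrite -?val_eqE /= /bump; lia.
Qed.

(** * The Euler map *)

Section Euler.
Variables (R : fieldType) (E : graded_space R).
Local Notation vvcochain := (seq E -> E).
Implicit Types (G K L : vvcochain) (k : nat) (x y : E).

Lemma vv_multilinear_ext K L : vv_multilinear K -> vv_multilinear L ->
  (forall p (delta : 'I_p -> gs_index E) z,
     K [seq gs_proj (delta j) (z j) | j <- enum 'I_p] =
     L [seq gs_proj (delta j) (z j) | j <- enum 'I_p]) -> K = L.
Proof.
move=> KL LL e; apply: funext => s.
(* [s1] is the prefix whose entries have already been split into components. *)
suff ext s2 s1 : (forall x, x \in s1 -> exists j, gs_proj j x = x) ->
  K (s1 ++ s2) = L (s1 ++ s2) by exact: (ext s [::]).
elim: s2 s1 => [|x s2 IH] s1 hs1.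
  rewrite cats0; have {}hs1 (i : 'I_(size s1)) : exists j, gs_proj j s1`_i = s1`_i.
    by apply: hs1; rewrite mem_nth.
  have [delta dE] := fin_all_exists hs1.
  have -> : s1 = [seq gs_proj (delta j) (s1`_j) | j <- enum 'I_(size s1)]; last exact: e.
  rewrite (eq_map dE); apply: (@eq_from_nth _ 0) => [|i si].
    by rewrite size_map size_enum_ord.
  by rewrite (nth_map (Ordinal si)) ?size_enum_ord // nth_enum_ord.
rewrite -(gs_proj_sum x) !vv_multilinear_sum //; apply: eq_bigr => j _.
rewrite -!cat_rcons; apply: IH => y; rewrite mem_rcons inE => /orP[/eqP->|/hs1 //].
by exists j; rewrite gs_proj_proj eqxx.
Qed.

Lemma insertion_pure K L p (delta : 'I_p -> gs_index E) z :
  vv_multilinear K -> vv_multilinear L ->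
  insertion K L [seq gs_proj (delta j) (z j) | j <- enum 'I_p] =
  \sum_(k < p.+1) unshuffle_sum K L k delta z.
Proof.
move=> KL LL; set s := map _ _.
have sE (j : 'I_p) : s`_j = gs_proj (delta j) (z j).
  by rewrite (nth_map j) ?size_enum_ord // nth_ord_enum.
have sp : size s = p by rewrite size_map size_enum_ord.
rewrite (insertionE _ _ sp) (bigD1 (finfun delta)) //= [X in _ + X]big1 ?addr0.
  apply: eq_bigr => k _; apply: eq_bigr => sigma _; congr (_ *: insert_term _ _ _ _).
    by congr koszul_sign; apply: funext => j; rewrite ffunE.
  by apply: eq_map => j; rewrite ffunE sE gs_proj_proj eqxx.
move=> delta' /eqP ne; apply: big1 => k _.
have [j jd] : exists j, delta' j != delta j.
  apply: contra_notP ne => ne; apply/ffunP => j; rewrite ffunE; apply/eqP.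
  by apply: contra_notT ne; exists j.
by rewrite (@unshuffle_sum0 _ _ _ _ _ _ j) // sE gs_proj_proj (negbTE jd).
Qed.

Lemma koszul_sign1 p (d : 'I_p -> int) : koszul_sign R d 1%g = 1.
Proof.
apply: big1 => a _; rewrite big_pred0 // => b; rewrite !perm1; lia.
Qed.

(** The Koszul sign is exactly what graded symmetry charges for bringing argument [j] to the front,
    one exchange of neighbours at a time. *)
Lemma lift_perm_koszul L q (j : 'I_q.+1) (delta : 'I_q.+1 -> gs_index E) z :
  graded_symmetric L ->
  let sigma := lift_perm ord0 j 1%g in
  koszul_sign R (fun a => gs_deg (delta a)) sigma *:
    L [seq gs_proj (delta (sigma a)) (z (sigma a)) | a <- enum 'I_q.+1] =
  L [seq gs_proj (delta a) (z a) | a <- enum 'I_q.+1].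
Proof.
move=> LS; case: j => n; elim: n delta z => [|n IH] delta z nq /=.
  have -> : Ordinal nq = ord0 by exact: val_inj.
  rewrite lift_perm1 koszul_sign1 scale1r; congr L.
  by apply: eq_map => a; rewrite perm1.
have nq' := ltnW nq; set j := Ordinal nq'; set j' := Ordinal nq.
have jj' : j' = j.+1 :> nat by [].
rewrite (lift_perm_step jj'); set sigma := lift_perm _ _ _.
have := koszul_sign_tperm_values R jj' (fun a => gs_deg (delta (tperm j j' a))) sigma.
rewrite (_ : _ \o _ = (fun a => gs_deg (delta a))) => [->|]; last first.
  by apply: funext => a /=; rewrite tpermK.
have := IH (delta \o tperm j j') (z \o tperm j j') nq'; rewrite -/j -/sigma /= => e.
rewrite -scalerA; under eq_map do rewrite permM.
rewrite {}e tpermL tpermR.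
have [s1 [s2 [-> _ fix12]]] := enum_split_adjacent jj'.
rewrite !map_cat /= tpermL tpermR.
rewrite [in RHS](LS _ _ _ _ _ _ (@proj_homogeneous _ _ _ _) (@proj_homogeneous _ _ _ _)).
rewrite mulrC.
have fx s : {subset s <= s1 ++ s2} ->
    [seq gs_proj (delta (tperm j j' a)) (z (tperm j j' a)) | a <- s] =
    [seq gs_proj (delta a) (z a) | a <- s].
  by move=> ss; apply/eq_in_map => a /ss; rewrite mem_cat => /fix12 ->.
by rewrite !fx // => a; rewrite mem_cat => ->; rewrite ?orbT.
Qed.

Local Arguments euler {R} E s : simpl never.

Lemma euler_homogeneous d x : homogeneous d x -> euler E [:: x] = (- d)%:~R *: x.
Proof.
move=> hx; rewrite -[in RHS](gs_proj_sum x) scaler_sumr /euler; apply: eq_bigr => j _.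
by have [->//|/hx ->] := eqVneq (gs_deg j) d; rewrite !scaler0.
Qed.

Lemma euler_size s : size s != 1 -> euler E s = 0.
Proof. by case: s => [|x []]. Qed.

Lemma euler_vvform : vvform 0 (euler E).
Proof.
split.
- case=> [|u s1] [|v s2] c x y; last 3 first.
  + by rewrite !euler_size // scaler0 addr0.
  + by rewrite !euler_size ?size_cat /= ?addnS // scaler0 addr0.
  + by rewrite !euler_size ?size_cat /= ?addnS // scaler0 addr0.
  rewrite /euler /=.
  rewrite scaler_sumr -big_split /=; apply: eq_bigr => j _.
  by rewrite gs_proj_linear scalerDr !scalerA mulrC.
- by move=> s1 s2 a b x y _ _; rewrite !euler_size ?size_cat /= ?addnS ?scaler0.
- case=> [|x [|y s]] ds dss hs; try exact: homogeneous0.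
  case: ds dss hs => [|d []] //= _ /(_ 0 (leqnn _)) /= hx.
  rewrite (euler_homogeneous hx) big_seq1 addr0.
  exact: homogeneousZ.
Qed.

(** The inner [euler] takes one argument, brought to the front by an unshuffle. It multiplies this
    argument by minus its degree, and the symmetry of [L] puts it back in place. *)
Lemma insertion_euler_l L p (delta : 'I_p -> gs_index E) z :
  vv_multilinear L -> graded_symmetric L ->
  let s := [seq gs_proj (delta j) (z j) | j <- enum 'I_p] in
  insertion (euler E) L s = (- \sum_j gs_deg (delta j))%:~R *: L s.
Proof.
move=> LL LS /=; have [SL _ _] := euler_vvform.
rewrite insertion_pure //.
(* [minn k p] is the number of arguments that [euler] receives. *)
have off k : minn k p != 1 -> unshuffle_sum (euler E) L k delta z = 0.
  move=> kp; apply: big1 => sigma _; rewrite /insert_term euler_size.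
    by rewrite (vv_multilinear0 [::]) ?scaler0.
  by rewrite size_take_min size_map size_enum_ord.
case: p delta z off => [|q] delta z off.
  rewrite big1 => [|k _]; first by rewrite big_ord0 oppr0 scale0r.
  by apply: off; rewrite minn0.
have q1 : (1 < q.+2)%N by [].
rewrite (bigD1 (Ordinal q1)) //= [X in _ + X]big1 ?addr0; last first.
  by move=> k; rewrite -val_eqE /= => k1; apply: off; move: (ltn_ord k) k1; lia.
rewrite /unshuffle_sum (reindex_onto (fun j => lift_perm ord0 j 1%g)
  (fun sigma : 'S_q.+1 => sigma ord0)) /=; last exact: unshuffle1_inv.
rewrite -sumrN rmorph_sum scaler_suml; apply: eq_big => j.
  by rewrite unshuffle1_lift_perm lift_perm_id eqxx.
move=> _; rewrite /insert_term [in LHS]enum_ordSl /= take0 drop0 lift_perm_id.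
rewrite (euler_homogeneous (@proj_homogeneous _ _ _ _)) (vv_multilinearZ [::]) //.
rewrite scalerA mulrC -scalerA -(lift_perm_koszul j delta z LS) /=.
by rewrite enum_ordSl /= lift_perm_id.
Qed.

(** The outer [euler] accepts a single argument, so [L] takes all of them in their order, and its
    value is multiplied by minus its degree. *)
Lemma insertion_euler_r b L p (delta : 'I_p -> gs_index E) z : vvform b L ->
  let s := [seq gs_proj (delta j) (z j) | j <- enum 'I_p] in
  insertion L (euler E) s = (- (\sum_j gs_deg (delta j) + b))%:~R *: L s.
Proof.
move=> [LL LS LD] /=; have [SL _ _] := euler_vvform.
rewrite insertion_pure // big_ord_recr big1 ?add0r /=; last first.
  move=> k _; apply: big1 => sigma _; rewrite /insert_term euler_size ?scaler0 //=.
  by rewrite size_drop size_map size_enum_ord; move: (ltn_ord k); lia.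
rewrite /unshuffle_sum (eq_bigl (pred1 1%g)); last exact: unshuffle_all.
rewrite big_pred1_eq koszul_sign1 scale1r /insert_term.
under eq_map do rewrite perm1.
rewrite take_oversize ?drop_oversize ?size_map -?enumT ?size_enum_ord //.
rewrite add0r; apply: euler_homogeneous.
have -> : \sum_j gs_deg (delta j) = \sum_(d <- [seq gs_deg (delta j) | j <- enum 'I_p]) d.
  by rewrite big_map big_enum.
apply: LD; first by rewrite !size_map.
move=> i; rewrite size_map size_enum_ord => ip.
rewrite !(nth_map (Ordinal ip)) -?enumT ?size_enum_ord //.
exact: proj_homogeneous.
Qed.

(** One insertion counts the degrees of the arguments, the other the degree of the value; they
    differ by [b]. *)
Lemma RN_euler b b' L : vvform b L -> RN 0 b' (euler E) L = b%:~R *: L.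
Proof.
move=> hL; have [LL LS LD] := hL; have [SL _ _] := euler_vvform.
apply: vv_multilinear_ext.
- by have [+ _ _] := RN_vvform euler_vvform hL; rewrite /RN !mul0r.
- by have [+ _ _] := vvformZ b%:~R hL.
move=> p delta z; rewrite /RN mul0r expr0z scale1r.
set s := map _ _.
rewrite -[LHS]/(insertion (euler E) L s - insertion L (euler E) s).
rewrite insertion_euler_l // (insertion_euler_r _ _ hL) -/s.
by rewrite -scalerBl -rmorphB /= opprK addrA addNr add0r.
Qed.

Lemma RN_eulerD N mu : vvform 1 mu -> RN 0 1 (euler E + N) mu = mu + RN 0 1 N mu.
Proof.
by move=> muF; have [muL _ _] := muF; rewrite RNDl // (RN_euler _ muF) scale1r.
Qed.

(** The square condition is (1 + D)^2 = 1 + 2D for D the bracket with [N]. The commutation condition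
    expands into [[N, N]] and brackets of [euler] with forms of degree 0, which [euler] multiplies
    by 0. *)
Lemma nijenhuis_euler N mu : vvform 1 mu -> vvform 0 N ->
  RN 0 0 N N = 0 -> RN 0 1 N (RN 0 1 N mu) = 0 ->
  nijenhuis mu (euler E + N) (euler E + (2 : R) *: N).
Proof.
move=> muF NF NN NNmu; have SF := euler_vvform; have DF := RN_vvform NF muF.
have TF := vvformD SF NF; have KF := vvformD SF (vvformZ (2 : R) NF).
have [muL _ _] := muF; have [SL _ _] := SF; have [TL _ _] := TF.
split => //.
  have [NL _ _] := NF.
  rewrite (RN_eulerD N muF) (RN_eulerD N (vvformD muF DF)) RNDr // NNmu addr0.
  rewrite (addrC (euler E)) RN_combl // (RN_euler _ muF) scale1r.
  by rewrite scaler_nat mulr2n [RHS]addrC addrA.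
have SN : RN 0 0 (euler E) N = 0 by rewrite (RN_euler _ NF) scale0r.
have [NL _ _] := NF; rewrite [euler E + 2 *: _]addrC RN_combr // !RNDl //.
rewrite SN NN [RN 0 0 N _]RN00C SN (RN_euler _ SF) scale0r.
by rewrite oppr0 !addr0 scaler0.
Qed.

End Euler.

(** * Forms with values in a graded subspace [P], or vanishing on it *)

Section Annihilation.
Variables (R : fieldType) (E : graded_space R) (P : E -> Prop).
Local Notation vvcochain := (seq E -> E).
Implicit Types (K L : vvcochain) (k : nat) (x y z : E).

Definition valued K := forall s, P (K s).
Definition annihilates L := forall s1 z s2, P z -> L (s1 ++ z :: s2) = 0.

Hypothesis P0 : P 0.
Hypothesis P_comb : forall c x y, P x -> P y -> P (c *: x + y).
Hypothesis P_proj : forall j z, P z -> P (gs_proj j z).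

Lemma insertion_eq0 K L : valued K -> annihilates L -> insertion K L = 0.
Proof.
move=> KP LP; apply: funext => s; rewrite /insertion.
apply: big1 => delta _; apply: big1 => k _; apply: big1 => sigma _.
by rewrite (LP [::]) ?scaler0.
Qed.

Lemma insertion_valued K L : valued L -> valued (insertion K L).
Proof.
have PD x y : P x -> P y -> P (x + y).
  by move=> Px; rewrite -[x]scale1r; exact: P_comb.
move=> LP s; rewrite /insertion.
do 3 (apply: big_ind => // ? _).
by rewrite -[_ *: _]addr0; apply: P_comb.
Qed.

(** An argument in [P] goes either to [K] or to a slot of [L] after the first. The first slot, which
    receives the value of [K], is exempted so that [L] may be l_1. *)
Lemma insertion_annihilates K L : vv_multilinear L -> annihilates K ->
  (forall y s1 z s2, P z -> L (y :: s1 ++ z :: s2) = 0) ->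
  annihilates (insertion K L).
Proof.
move=> LL KP LP s1 z s2 Pz; set p := size (s1 ++ z :: s2).
have jp : (size s1 < p)%N by rewrite /p size_cat /= -addSnnS leq_addr.
rewrite (insertionE _ _ (erefl p)); apply: big1 => delta _; apply: big1 => k _.
apply: big1 => sigma _.
have [t1 [t2 [-> _ _ _]]] := enum_split ((sigma^-1)%g (Ordinal jp)).
rewrite map_cat /= permKV /= nth_cat ltnn subnn /=.
have := P_proj (delta (Ordinal jp)) Pz; move: (gs_proj _ z) => y Py.
rewrite /insert_term take_cat drop_cat; case: ltnP => kt.
  by rewrite LP ?scaler0.
case: (k - _)%N => [|m] /=; first by rewrite cats0 (LP _ [::]) ?scaler0.
by rewrite KP // (vv_multilinear0 [::]) // scaler0.
Qed.

End Annihilation.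

(** * Hamiltonian forms *)

Section HamiltonianForms.
Variables (R : realType) (m : nat) (M : manifold R m) (n : nat) (omega : plectic M n).
Local Notation A := (smooth_fun M).
Local Notation V := (vector_field M).
Local Notation cochain := (seq V -> A).
Local Notation E := (lie_graded omega).
Implicit Types (w : cochain) (x y : lie_space omega) (k : nat).

(** Vector fields are a module over the smooth functions, so a real scalar acts on them through the
    constant function [c *: 1]. *)
Lemma multilinear_scale (w : cochain) s1 s2 (c : R) X Y : multilinear w ->
  w (s1 ++ ((c *: (1 : A)) *: X + Y) :: s2) = c *: w (s1 ++ X :: s2) + w (s1 ++ Y :: s2).
Proof. by move=> ->; rewrite -smooth_scaler_mul mul1r. Qed.

Lemma hamiltonian_inj w X Y :
  hamiltonian omega w X -> hamiltonian omega w Y -> X = Y.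
Proof.
rewrite /hamiltonian => -> /oppr_inj XY; have [oL _ _] := df_form omega.
apply/eqP; rewrite -subr_eq0; apply/eqP; apply: vf_eqP => f.
apply: val_inj; apply: funext => p.
apply: (@plectic_nondegenerate _ _ _ _ omega p (X - Y)) => s; rewrite /contract.
rewrite addrC -scaleN1r (oL [::]) /=.
move: (congr1 (fun h : cochain => h s) XY); rewrite /contract => ->.
by rewrite mulN1r addNr.
Qed.

(** [ham_vf] is an arbitrary choice among Hamiltonian vector fields; uniqueness is what makes it
    linear. *)
Lemma ham_vf_lin (c : R) x y :
  ham_vf (c *: x + y) = (c *: (1 : A)) *: ham_vf x + ham_vf y.
Proof.
apply: hamiltonian_inj (ham_vfP _) _; have [oL _ _] := df_form omega.
rewrite /hamiltonian form_part_lin ext_d_lin !ham_vfP; apply: funext => s.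
rewrite -[RHS]/(- omega ([::] ++ (_ *: _ + _) :: s)) multilinear_scale //.
by rewrite opprD -scalerN.
Qed.

Lemma ham_vf_closed x : ext_d (form_part n.-1 x) = 0 -> ham_vf x = 0.
Proof. by move=> dx; apply: hamiltonian_inj (ham_vfP _) _; exact: hamiltonian0. Qed.

Lemma ext_d_zero : ext_d (0 : cochain) = 0.
Proof. exact: ext_d0. Qed.

Lemma ham_vf_vanishing x : (forall s, size s = n.-1 -> x s = 0) -> ham_vf x = 0.
Proof.
move=> x0; apply: ham_vf_closed; rewrite (_ : form_part _ _ = 0) ?ext_d_zero //.
by apply: funext => s; rewrite /form_part; case: eqP => // /x0.
Qed.

(** Degree [d] in E is form degree n + d; the component of form degree [size s] has index n - (size
    s + 1). *)
Lemma homogeneous_lieP (d : int) x :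
  homogeneous (E := E) d x <-> (forall s, (size s)%:Z - n%:Z != d -> x s = 0).
Proof.
split=> [hx s sd|x0 j jd]; last first.
  apply: val_inj; apply: funext => s; rewrite /= /form_part; case: eqP => // sj.
  apply: x0; apply: contraNneq jd => <-; rewrite sj /= /lie_deg.
  by move: (ltn_ord j); lia.
have [sn|ns] := ltnP (size s) n; last by have [_ _ ->] := lie_spaceP x.
have jn : (n - (size s).+1 < n)%N by rewrite ltn_subrL; case: n sn.
have := hx (Ordinal jn); rewrite /= /lie_deg /=.
have -> : - (n - (size s).+1).+1%:Z != d.
  by apply: contraNneq sd => <-; move: sn; lia.
move=> /(_ isT) /(congr1 (fun y => val y s)) /=; rewrite /form_part.
by rewrite subnSK // subKn ?eqxx // ltnW.
Qed.

Lemma ham_vf_homogeneous d x : homogeneous (E := E) d x -> d != -1 -> ham_vf x = 0.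
Proof.
move=> /homogeneous_lieP hx d1; apply: ham_vf_vanishing => s sn.
have [ns|n0] := leqP n (size s); first by have [_ _ ->] := lie_spaceP x.
by apply: hx; apply: contraNneq d1 => <-; move: n0; rewrite sn; lia.
Qed.

(** The subspace [P] of the previous section: it contains every component of degree below -1, and
    the closed forms in E_(-1). *)
Definition ham_trivial (x : E) : Prop := ham_vf (x : lie_space omega) = 0.

Lemma ham_trivial0 : ham_trivial 0.
Proof. by apply: ham_vf_vanishing. Qed.

Lemma ham_trivial_comb c (x y : E) :
  ham_trivial x -> ham_trivial y -> ham_trivial (c *: x + y).
Proof.
rewrite /ham_trivial => hx hy; rewrite (ham_vf_lin c (x : lie_space omega) y) hx hy.
by rewrite scaler0 addr0.
Qed.

Lemma ham_trivial_proj j (x : E) : ham_trivial x -> ham_trivial (gs_proj j x).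
Proof.
move=> hx; have := ham_vfP (x : lie_space omega); rewrite hx => dx.
apply: hamiltonian_inj (ham_vfP _) _; rewrite /= form_part_form_part.
case: eqP => [<-//|_]; apply: hamiltonian0 => //; exact: ext_d_zero.
Qed.

Lemma lie_val_comb (c : R) x y t :
  lie_val (c *: x + y) t = c *: lie_val x t + lie_val y t.
Proof. by []. Qed.

(** The outermost contraction supplies its vector field last, next to [t], whence the reversals. *)
Lemma ham_contracts_split xs x ys w t :
  ham_contracts (xs ++ x :: ys) w t =
  w (rev (map (@ham_vf _ _ _ _ omega) ys) ++ ham_vf x ::
     rev (map (@ham_vf _ _ _ _ omega) xs) ++ t).
Proof.
by rewrite /ham_contracts contractsE map_cat catrevE rev_cat rev_cons cat_rcons -catA.
Qed.

(** * Contractions of an N-form with Hamiltonian vector fields, for omega ([lie_l]) and eta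
    ([eta_tilde]) *)

Section HamVvform.
Variables (N k : nat) (w : cochain) (c : R) (K : seq E -> E).
Hypothesis wF : is_form N w.
Hypothesis k1 : (1 < k)%N.
Hypothesis KE : forall (xs : seq (lie_space omega)) t,
  val (K xs : lie_space omega) t = if size xs == k then c *: ham_contracts xs w t else 0.

Lemma ham_multilinear : vv_multilinear K.
Proof.
have [wL _ _] := wF.
move=> s1 s2 e x y; apply: val_inj; apply: funext => t.
apply: etrans (esym (lie_val_comb e (K (s1 ++ x :: s2)) (K (s1 ++ y :: s2)) t)).
rewrite !KE !size_cat /=; case: ifP => _; last by rewrite scaler0 addr0.
rewrite !ham_contracts_split /= (ham_vf_lin e (x : lie_space omega) y).
by rewrite multilinear_scale // scalerDr !scalerA mulrC.
Qed.

Lemma ham_annihilates : annihilates ham_trivial K.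
Proof.
have [wL _ _] := wF; move=> s1 z s2 hz; apply: val_inj; apply: funext => t.
rewrite KE ham_contracts_split (hz : ham_vf (z : lie_space omega) = 0).
by rewrite multilinear0 // scaler0; case: ifP.
Qed.

(** The values have form degree N - k, and only form degree n - 1 contributes a Hamiltonian vector
    field. The excluded case is k = 2 for omega and k = 1 for eta. *)
Lemma ham_valued : (k + n.-1)%N != N -> valued ham_trivial K.
Proof.
move=> kN xs; apply: ham_vf_vanishing => t tn; rewrite KE; case: eqP => // xk.
by rewrite /ham_contracts (contracts_size wF) ?scaler0 // size_map xk tn.
Qed.

(** Arguments outside E_(-1) are killed. Those in E_(-1) have odd degree, so graded symmetry is
    antisymmetry there, and [w] is alternating. *)
Lemma ham_symmetric : graded_symmetric K.
Proof.
have [wL wA _] := wF; move=> s1 s2 a b x y hx hy.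
have [a1|/(ham_vf_homogeneous hx) x0] := eqVneq a (-1); last first.
  rewrite ham_annihilates // -cat_rcons ham_annihilates ?scaler0 //.
have [b1|/(ham_vf_homogeneous hy) y0] := eqVneq b (-1); last first.
  rewrite -cat_rcons ham_annihilates // ham_annihilates ?scaler0 //.
rewrite a1 b1 mulrNN mulr1 expr1z scaleN1r; apply: val_inj; apply: funext => t.
rewrite -[RHS]/(- val (K (s1 ++ y :: x :: s2)) t) !KE !size_cat /=.
case: ifP => _; last by rewrite oppr0.
rewrite !ham_contracts_split /= !rev_cons !cat_rcons form_swap //.
by rewrite scalerN.
Qed.

(** From k arguments of degree -1 to a form of degree N - k, that is, degree N - k - n in E: the
    shift is 0 for eta and 1 for omega. *)
Lemma ham_degree : has_degree (N%:Z - n%:Z) K.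
Proof.
move=> s ds dss hs; apply/homogeneous_lieP => t td; rewrite KE; case: eqP => // sk.
have [ds1|/allPn[d dds d1]] := boolP (all (pred1 (-1 : int)) ds).
  rewrite /ham_contracts (contracts_size wF) ?scaler0 // size_map.
  apply: contraNneq td => <-; rewrite (eq_big_seq (fun=> -1)) => [|d /(allP ds1)/eqP //].
  by rewrite big_const_seq count_predT iter_addr_0 dss mulNrn natz sk; lia.
have si : (index d ds < size s)%N by rewrite -dss index_mem.
have := hs _ si; rewrite nth_index // => /ham_vf_homogeneous/(_ d1) sd0.
have [wL _ _] := wF; rewrite -(cat_take_drop (index d ds) s) (drop_nth 0 si).
by rewrite ham_contracts_split sd0 multilinear0 // scaler0.
Qed.

Lemma ham_vvform : vvform (N%:Z - n%:Z) K.
Proof. by split; [exact: ham_multilinear|exact: ham_symmetric|exact: ham_degree]. Qed.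

End HamVvform.

Lemma lie_lE k (xs : seq (lie_space omega)) t : (1 < k)%N ->
  val (lie_l omega k xs : lie_space omega) t =
  if size xs == k then lie_sign R k *: ham_contracts xs omega t else 0.
Proof.
move=> k1; rewrite /lie_l; case: eqP => // xk; rewrite -xk in k1 *.
by case: xs k1 {xk} => [|x [|y xs]].
Qed.

Lemma eta_tildeE (eta : diff_form M n) i (xs : seq (lie_space omega)) t : (1 < i)%N ->
  val (eta_tilde omega eta i xs : lie_space omega) t =
  if size xs == i then 1 *: ham_contracts xs eta t else 0.
Proof.
move=> i1; rewrite /eta_tilde; case: eqP => // xi; rewrite -xi in i1 *.
by rewrite /= i1 scale1r.
Qed.

Lemma lie_l_size k (xs : seq E) : size xs != k -> lie_l omega k xs = 0.
Proof. by rewrite /lie_l => /negbTE ->. Qed.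

Lemma lie_l1_multilinear : vv_multilinear (lie_l omega 1).
Proof.
case=> [|u s1] [|v s2] c x y; last 3 first.
- by rewrite !lie_l_size // scaler0 addr0.
- by rewrite !lie_l_size ?size_cat /= ?addnS // scaler0 addr0.
- by rewrite !lie_l_size ?size_cat /= ?addnS // scaler0 addr0.
apply: val_inj; apply: funext => t.
rewrite -[RHS]/(c *: val (lie_l1 x) t + val (lie_l1 y) t) /=.
elim/big_rec3 : _ => [|j w3 w2 w1 _ e]; first by rewrite scaler0 addr0.
set a := (-1) ^ _.
rewrite -[LHS]/(a *: ext_d (form_part (n - j.+1) (c *: val x + val y)) t + w1 t).
rewrite -[X in _ = c *: X + _]/(a *: ext_d (form_part (n - j.+1) (val x)) t + w2 t).
rewrite -[X in _ = _ + X]/(a *: ext_d (form_part (n - j.+1) (val y)) t + w3 t).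
rewrite e form_part_lin ext_d_lin.
rewrite -[(c *: _ + _) t]/(c *: ext_d (form_part (n - j.+1) (val x)) t +
  ext_d (form_part (n - j.+1) (val y)) t).
by rewrite !scalerDr !scalerA [a * c]mulrC addrACA.
Qed.

Lemma is_form_lie_part (j : 'I_n) x : is_form (n - j.+1) (lie_part j x).
Proof.
have [xL xA _ _] := lie_spaceP (lie_part j x); split => // s.
by rewrite /= /form_part => /negbTE ->.
Qed.

Lemma lie_l1_vvform : vvform 1 (lie_l omega 1).
Proof.
split; first exact: lie_l1_multilinear.
  move=> s1 s2 a b x y _ _.
  by rewrite !lie_l_size ?size_cat /= ?addnS ?scaler0.
case=> [|x [|y s]] ds dss hs; try exact: homogeneous0.
case: ds dss hs => [|d []] //= _ /(_ 0 (leqnn _)) /= hx.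
rewrite big_seq1; apply/homogeneous_lieP => t td /=.
apply: (big_ind (fun w : cochain => w t = 0)) => //.
  move=> w1 w2 e1 e2; rewrite -[LHS]/(w1 t + w2 t) e1 e2 addr0 //.
move=> j _; rewrite -[LHS]/(_ *: ext_d (lie_part j x) t).
have [jd|jd] := eqVneq (lie_deg j) d; last first.
  rewrite (_ : lie_part j x = 0); last exact: hx.
  by rewrite [X in X t]ext_d_zero scaler0.
have [_ _ ->] := is_form_ext_d (is_form_lie_part j x); first by rewrite scaler0.
apply: contraNneq td => ->; rewrite -jd /lie_deg; move: (ltn_ord j); lia.
Qed.

Lemma ext_d_form_part k N w : is_form N w -> ext_d w = 0 -> ext_d (form_part k w) = 0.
Proof.
move=> [_ _ w0] dw; have [<-|Nk] := eqVneq N k.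
  rewrite (_ : form_part N w = w) //; apply: funext => s; rewrite /form_part.
  by case: eqP => // /eqP/w0.
rewrite (_ : form_part k w = 0) ?ext_d_zero //; apply: funext => s.
by rewrite /form_part; case: eqP => // sk; rewrite w0 // sk eq_sym.
Qed.

Lemma lie_l1_valued : valued ham_trivial (lie_l omega 1).
Proof.
move=> s; rewrite /lie_l; case: eqP => [|_]; last exact: ham_trivial0.
case: s => [|x []] //= _; apply: ham_vf_closed => /=.
apply: (big_ind (fun w : cochain => ext_d (form_part n.-1 w) = 0)).
- rewrite (_ : form_part _ 0 = 0) ?ext_d_zero //.
  by apply: funext => s; rewrite /form_part; case: ifP.
- by move=> w1 w2 e1 e2; rewrite -[w1]scale1r form_part_lin ext_d_lin e1 e2 scaler0 addr0.
move=> j _; rewrite -[_ *: _]addr0 form_part_lin ext_d_lin.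
have xF := is_form_lie_part j x; have [xL xA _] := xF.
rewrite (ext_d_form_part _ (is_form_ext_d xF) (ext_dK xL xA)) scaler0 add0r.
rewrite (_ : form_part _ 0 = 0) ?ext_d_zero //.
by apply: funext => s; rewrite /form_part; case: ifP.
Qed.

Lemma lie_l_vvform k : (0 < k)%N -> vvform 1 (lie_l omega k).
Proof.
case: k => [|[|k]] // _; first exact: lie_l1_vvform.
have := ham_vvform (df_form omega) _ (fun xs t => lie_lE xs t (isT : (1 < k.+2)%N)).
by rewrite (_ : n.+1%:Z - n%:Z = 1); [exact|lia].
Qed.

Lemma lie_l_annihilates k : (1 < k)%N -> annihilates ham_trivial (lie_l omega k).
Proof.
by move=> k1; exact: ham_annihilates (df_form omega) (fun xs t => lie_lE xs t k1).
Qed.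

Lemma lie_l_valued k : (0 < n)%N -> (2 < k)%N -> valued ham_trivial (lie_l omega k).
Proof.
move=> n0 k2; apply: ham_valued (df_form omega) (fun xs t => lie_lE xs t (ltnW k2)) _.
by move: k2 n0; lia.
Qed.

Lemma lie_mu_split : (0 < n)%N ->
  lie_mu omega = lie_l omega 1 + lie_l omega 2 + \sum_(3 <= k < n.+2) lie_l omega k.
Proof. by move=> n0; rewrite /lie_mu big_ltn // big_ltn // addrA. Qed.

Lemma lie_sum_ind (Q : (seq E -> E) -> Prop) a b : Q 0 ->
  (forall K L, Q K -> Q L -> Q (K + L)) ->
  (forall k, (a <= k)%N -> Q (lie_l omega k)) ->
  Q (\sum_(a <= k < b) lie_l omega k).
Proof.
move=> Q0 QD Ql; rewrite big_nat_cond; apply: (big_ind Q) => // k.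
by rewrite andbT => /andP[/Ql].
Qed.

Lemma lie_mu_vvform : vvform 1 (lie_mu omega).
Proof.
apply: lie_sum_ind; [exact: vvform0|exact: vvformD|exact: lie_l_vvform].
Qed.

(** * Brackets of [eta_tilde] with [lie_mu] and with itself *)

Section EtaTilde.
Variables (eta : diff_form M n) (i : nat).
Hypothesis hi : (2 <= i <= n)%N.
Local Notation etai := (eta_tilde omega eta i).

Let i1 : (1 < i)%N. Proof. by case/andP: hi. Qed.
Let n0 : (0 < n)%N. Proof. by move: hi; lia. Qed.

Lemma eta_tilde_vvform : vvform 0 etai.
Proof.
have := ham_vvform (df_form eta) i1 (fun xs t => eta_tildeE eta xs t i1).
by rewrite subrr.
Qed.

Lemma eta_tilde_annihilates : annihilates ham_trivial etai.
Proof. exact: ham_annihilates (df_form eta) (fun xs t => eta_tildeE eta xs t i1). Qed.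

Lemma eta_tilde_valued : valued ham_trivial etai.
Proof.
apply: ham_valued (df_form eta) (fun xs t => eta_tildeE eta xs t i1) _.
by move: hi; lia.
Qed.

Let insertion0 K L : valued ham_trivial K -> annihilates ham_trivial L ->
  insertion K L = 0 := @insertion_eq0 _ _ _ K L.

Lemma RN_eta_tilde_eq0 a b (K : seq E -> E) :
  valued ham_trivial K -> annihilates ham_trivial K -> RN a b etai K = 0.
Proof.
move=> KP PK; rewrite /RN !insertion0 ?scaler0 ?subr0 //.
- exact: eta_tilde_annihilates.
- exact: eta_tilde_valued.
Qed.

Lemma RN_eta_tilde_mu : RN 0 1 etai (lie_mu omega) =
  RN 0 1 etai (lie_l omega 1) + RN 0 1 etai (lie_l omega 2).
Proof.
have [eL _ _] := eta_tilde_vvform.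
rewrite (lie_mu_split n0).
do 2 (rewrite RNDr; last exact: eL).
set r := \sum_(_ <= _ < _) _.
rewrite (@RN_eta_tilde_eq0 _ _ r); first exact: addr0.
- apply: lie_sum_ind => [s|K L KP LP s|k k3]; first exact: ham_trivial0.
    rewrite -[(K + L) s]/(K s + L s) -[K s]scale1r.
    by apply: ham_trivial_comb; [exact: KP|exact: LP].
  exact: lie_l_valued.
- apply: lie_sum_ind => [|K L KP LP s1 z s2 hz|k k3] //.
    by rewrite -[LHS]/(K _ + L _) KP // LP // addr0.
  by apply: lie_l_annihilates; exact: ltnW.
Qed.

(** Two of the four insertions vanish: eta~_i kills the values of l_1, and l_2 kills the values of
    eta~_i. *)
Lemma RN_eta_tilde_muE : RN 0 1 etai (lie_mu omega) =
  insertion etai (lie_l omega 1) - insertion (lie_l omega 2) etai.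
Proof.
rewrite RN_eta_tilde_mu !RN0E.
rewrite [insertion (lie_l omega 1) _]insertion0; last 2 first.
- exact: lie_l1_valued.
- exact: eta_tilde_annihilates.
rewrite [insertion _ (lie_l omega 2)]insertion0; last 2 first.
- exact: eta_tilde_valued.
- exact: lie_l_annihilates.
by rewrite subr0 sub0r.
Qed.

Lemma RN_eta_tilde2_mu : RN 0 1 etai (RN 0 1 etai (lie_mu omega)) = 0.
Proof.
have [etaL _ _] := eta_tilde_vvform.
have l1V : valued ham_trivial (insertion etai (lie_l omega 1)).
  exact: (insertion_valued ham_trivial0 ham_trivial_comb _ lie_l1_valued).
have l1A : annihilates ham_trivial (insertion etai (lie_l omega 1)).
  apply: (insertion_annihilates ham_trivial_proj lie_l1_multilinear).
    exact: eta_tilde_annihilates.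
  (* l_1 has no slot besides the one filled by eta~_i. *)
  by move=> y s1 z s2 _; rewrite lie_l_size //= size_cat /= addnS.
have l2V : valued ham_trivial (insertion (lie_l omega 2) etai).
  exact: (insertion_valued ham_trivial0 ham_trivial_comb _ eta_tilde_valued).
have l2A : annihilates ham_trivial (insertion (lie_l omega 2) etai).
  apply: (insertion_annihilates ham_trivial_proj etaL (lie_l_annihilates _)) => //.
  by move=> y s1 z s2; exact: (eta_tilde_annihilates (y :: s1)).
rewrite RN_eta_tilde_muE -scaleN1r addrC RN_combr //.
by rewrite !RN_eta_tilde_eq0 // scaler0 addr0.
Qed.

Lemma RN_eta_tilde_eta_tilde : RN 0 0 etai etai = 0.
Proof. exact: RN_eta_tilde_eq0 eta_tilde_valued eta_tilde_annihilates. Qed.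

End EtaTilde.
End HamiltonianForms.

Theorem proposition3p7 (R : realType) (m : nat) (M : manifold R m) (n : nat)
    (omega : plectic M n) (eta : diff_form M n) (i : nat)
    (hi : (2 <= i <= n)%N) :
  let S := euler (lie_graded omega) in
  let mu := lie_mu omega in
  let l1 := lie_l omega 1 in
  let l2 := lie_l omega 2 in
  let etai := eta_tilde omega eta i in
  nijenhuis mu (S + etai) (S + (2 : R) *: etai) /\
  RN 0 1 (S + etai) mu = mu + RN 0 1 etai l1 + RN 0 1 etai l2.
Proof.
have muF := lie_mu_vvform omega; split.
  apply: nijenhuis_euler muF (eta_tilde_vvform omega eta hi) _ _.
    exact: RN_eta_tilde_eta_tilde.
  exact: RN_eta_tilde2_mu.
apply: etrans (RN_eulerD _ muF) _.
rewrite (RN_eta_tilde_mu _ _ hi).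
exact: addrA.
Qed.
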